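(* Let $\beta_0^\star\in\mathbb{R}$, let $\Gamma\subset\mathbb{R}$ be a compact set which does not contain $0$, and let $\gamma_1^\star\in\Gamma$. Assume that $Y_1,\dots,Y_n$ are the first $n$ observations of the GLARMA model with parameters $(\beta_0^\star,\gamma_1^\star)$ described in the context (no covariates, $q=1$), and that the process $(W_t^\star)$ is started with its stationary invariant distribution. Let $\widehat{\gamma}_1$ be defined by $$\widehat{\gamma}_1=\mathrm{Argmax}_{\gamma_1\in\Gamma}\; L(\beta_0^\star,\gamma_1),$$ where $$L(\beta_0^\star,\gamma_1)=\sum_{t=1}^n\Big(Y_t W_t(\beta_0^\star,\gamma_1)-\exp\big(W_t(\beta_0^\star,\gamma_1)\big)\Big)$$ and $W_t(\beta_0^\star,\gamma_1)$ is the recursively defined quantity given in the context. Then $\widehat{\gamma}_1\stackrel{p}{\longrightarrow}\gamma_1^\star$ as $n$ tends to infinity, where $\stackrel{p}{\longrightarrow}$ denotes convergence in probability.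
   Context: Model. $(Y_t)_{t\ge 1}$ is a sequence of nonnegative integer-valued random variables and $(W_t^\star)_{t\geq 1}$ a real-valued process such that, for all $t\ge 1$, conditionally on the past $\mathcal{F}_{t-1}=\sigma(W_1^\star,Y_1,\dots,Y_{t-1})$, $Y_t$ has the Poisson distribution with mean $\mu_t^\star=\exp(W_t^\star)$. Moreover $W_t^\star=\beta_0^\star+Z_t^\star$ with $Z_t^\star=\gamma_1^\star E_{t-1}^\star$ and $E_t^\star=(Y_t-\mu_t^\star)/\mu_t^\star=Y_t\exp(-W_t^\star)-1$; that is, for $t\ge 2$, $W_t^\star=(\beta_0^\star-\gamma_1^\star)+\gamma_1^\star Y_{t-1}\exp(-W_{t-1}^\star)$, so $(W_t^\star)$ is a Markov chain. ''Started with its stationary invariant distribution'' means that $W_1^\star$ is distributed according to the stationary invariant distribution of this Markov chain. Criterion. For $\gamma_1\in\mathbb{R}$, the functions $W_t(\beta_0^\star,\gamma_1)$ of the observations are defined recursively by $$W_t(\beta_0^\star,\gamma_1)=\beta_0^\star+Z_t(\gamma_1)=\beta_0^\star+\gamma_1E_{t-1}(\gamma_1),$$ where $E_{t-1}(\gamma_1)=Y_{t-1}\exp(-W_{t-1}(\beta_0^\star,\gamma_1))-1$ if $t>1$ and $E_{t-1}(\gamma_1)=0$ if $t\le 1$. In particular $W_1(\beta_0^\star,\gamma_1)=\beta_0^\star$. The parameter $\beta_0^\star$ is treated as known. *)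

(* Defs.v *)
From HB Require Import structures.
From mathcomp Require Export all_boot all_order all_algebra.
From mathcomp Require Export all_classical all_reals all_analysis measurable_realfun.
Export Order.TTheory GRing.Theory Num.Theory.
Export numFieldNormedType.Exports.

Set Implicit Arguments.
Unset Strict Implicit.
Unset Printing Implicit Defensive.

Local Open Scope classical_set_scope.
Local Open Scope ring_scope.

(* All processes are indexed as (X_t)_{t >= 1}: the value of a process at
   index 0 is never constrained. *)

Section Probability.
Context {R : realType}.

(* [G] is meant to be a sigma-algebra. The first conjunct is the measurability, with respect to the
   sigma-algebra [G] itself, that a version of a conditional probability given
   [G] must have. *)
Definition conditional_law d (T : measurableType d) (P : probability T R)
    (G : set (set T)) d' (S : measurableType d') (X : T -> S)
    (kappa : T -> set S -> \bar R) : Prop :=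
  (forall B, measurable B ->
     measurable_fun setT (kappa ^~ B : g_sigma_algebraType G -> \bar R)) /\
  (forall A B, G A -> measurable B ->
     P (A `&` X @^-1` B) = (\int[P]_(w in A) kappa w B)%E).

Definition invariant_distribution d (S : measurableType d)
    (K : S -> set S -> \bar R) (nu : set S -> \bar R) : Prop :=
  forall A, measurable A -> nu A = (\int[nu]_x K x A)%E.

Definition cvg_in_probability d (T : measurableType d) (P : probability T R)
    (X : nat -> {RV P >-> R}) (Z : T -> R) : Prop :=
  forall eps : R, 0 < eps ->
    P [set w | eps < `|X n w - Z w|] @[n --> \oo] --> 0%E.

End Probability.

Arguments cvg_in_probability {R d T} P X Z.

Section Glarma.
Context {R : realType}.

(* [poisson_prob] takes a second argument on which it does not depend. *)
Definition poisson_law (mu : R) : set nat -> \bar R := poisson_prob mu 0%N.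

Definition glarma_error (w : R) (y : nat) : R := (y%:R - expR w) / expR w.

(* The sigma-algebra generated by W_1, Y_1, ..., Y_(t-1). *)
Definition glarma_history d (T : measurableType d)
    (Y : nat -> {mfun T >-> nat}) (W : nat -> {mfun T >-> R}) (t : nat) : set (set T) :=
  <<s preimage_set_system setT (W 1%N) measurable `|`
      \bigcup_(s in [set s | (1 <= s < t)%N])
        preimage_set_system setT (Y s) measurable >>.

(* Law of [W_t] given [W_(t-1) = w]. *)
Definition glarma_kernel (beta0 gamma1 w : R) : set R -> \bar R :=
  pushforward (poisson_law (expR w))
    (fun y : nat => beta0 + gamma1 * glarma_error w y).

Definition glarma_model d (T : measurableType d) (P : probability T R)
    (beta0 gamma1 : R) (Y : nat -> {RV P >-> nat}) (W : nat -> {RV P >-> R}) : Prop :=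
  (forall t, (1 <= t)%N ->
     conditional_law P (glarma_history Y W t) (Y t)
       (fun w => poisson_law (expR (W t w)))) /\
  (forall t, (2 <= t)%N -> forall w,
     W t w = beta0 + gamma1 * glarma_error (W t.-1 w) (Y t.-1 w)).

(* The criterion is started at [beta0], not at the unobserved [W_1]. *)
Fixpoint glarma_W (beta0 gamma1 : R) (y : nat -> nat) (t : nat) : R :=
  beta0 + gamma1 *
    (if t is s.+1 then
       if (1 <= s)%N then (y s)%:R * expR (- glarma_W beta0 gamma1 y s) - 1
       else 0
     else 0).

Definition glarma_L (beta0 gamma1 : R) (y : nat -> nat) (n : nat) : R :=
  \sum_(1 <= t < n.+1)
    ((y t)%:R * glarma_W beta0 gamma1 y t - expR (glarma_W beta0 gamma1 y t)).

Definition is_argmax (A : set R) (f : R -> R) (x : R) : Prop :=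
  A x /\ forall z, A z -> f z <= f x.

End Glarma.

Arguments glarma_model {R d T} P beta0 gamma1 Y W.

(* Main.v *)
Require Import Defs.
From mathcomp Require Import ring lra zify.

(** Write [mu_t = exp W_t] for the true conditional mean and [W_t(g)] for the
    filtered value at the parameter [g].  The gain of [g] over the truth at
    time [t] is, with [D_t = W_t(g) - W_t],
      Y_t D_t - mu_t (exp D_t - 1)
        = (Y_t - mu_t) D_t - mu_t (exp D_t - 1 - D_t),
    a martingale increment minus a nonnegative loss.  Consistency amounts to
    showing that, uniformly in the [g] at distance at least [eps] from
    [gamma1], the accumulated loss is linear in the number of observations and
    beats the martingale and the effect of the unknown starting point.

    The whole argument rests on the fact that an observation equal to zero
    erases the memory of the recursion: if [Y_(t-1) = 0] then
    [W_t(g) = beta0 - g] whatever happened before ([foldl_step_forget]).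
    - After the first zero the filter at [gamma1] coincides with [W], so that
      starting it at [beta0] costs an error that does not grow with the sample
      size ([start_error_ge]).
    - Just after a zero, [D_t = gamma1 - g] exactly, so every zero costs at
      least a constant [separation] to a parameter far from [gamma1]
      ([gain_good]).
    - Call [t] good when the last [k] observations are below [m] and one of
      them is zero.  At good times [W_t] and [W_t(g)] are functions of these
      [k] observations, which can only take finitely many values.  Hence the
      martingale part, restricted to good times, is a combination of finitely
      many martingales that do not depend on [g] ([window_sum]), with
      coefficients that are bounded uniformly in [g].  This replaces a uniform
      law of large numbers.
    - At bad times the gain is at most [(Y_t - mu_t)^2 / mu_t], for every value
      of the filter ([gain_chi2]), and this has conditional mean one
      ([integral_chi2]).  In expectation, bad times therefore cost no more than
      a multiple of their number.
    Bad times are rare because zeros are frequent and [Y] is tight.  Whatever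
    the past, [Y_t exp(- W_t)] has conditional mean one, so by Markov's
    inequality [W_(t+1)] is below a fixed constant with conditional probability
    at least one half, and then [Y_(t+1)] vanishes with a probability bounded
    below ([nonzero_decay]).  A window of length [k] thus has no zero with a
    probability that is geometrically small in [k].  This matters, since good
    times only guarantee one zero every [k] steps: the proportion of bad times
    must be small compared with [1 / k].

    These facts combine on each path into [argmax_bound], whose right-hand side
    is controlled by Markov's inequality with one second moment for the
    martingales and one first moment for the bad times. *)

Set Implicit Arguments.
Unset Strict Implicit.
Unset Printing Implicit Defensive.

Local Open Scope classical_set_scope.
Local Open Scope ring_scope.

(** * Elementary estimates *)

(** Up to a factor two, [j] is the length of the window, hence the inverse of
    the frequency of zeros that good times guarantee. *)
Lemma exists_geometric_le (R : realType) (r th : R) : 0 < r < 1 -> 0 < th ->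
  exists2 j, (0 < j)%N & j%:R * (1 - r) ^+ j <= th.
Proof.
move=> /andP[r0 r1] th0; pose j := (Num.truncn (4 / (r ^+ 2 * th))).+1.
exists j => //; have jR : 0 < j%:R :> R by rewrite ltr0n.
have u0 : 0 < j%:R * r by rewrite mulr_gt0.
have : (1 - r) ^+ j <= expR (- (j%:R * r)).
  have r1' : 1 - r <= expR (- r) by have := expR_ge1Dx (- r); lra.
  rewrite -mulrN mulrC expRM_natr; apply: lerXn2r r1'; rewrite nnegrE ?expR_ge0//.
  lra.
move=> /(ler_wpM2l (ltW jR)) h; apply: le_trans h _.
rewrite expRN ler_pdivrMr ?expR_gt0//.
have sq : (j%:R * r) ^+ 2 / 4 <= expR (j%:R * r).
  rewrite [X in expR X]splitr expRD -expr2.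
  have -> : (j%:R * r) ^+ 2 / 4 = (j%:R * r / 2) ^+ 2 by field.
  rewrite ler_pXn2r ?nnegrE ?expR_ge0 ?divr_ge0 ?(ltW u0)//.
  by apply: le_trans (expR_ge1Dx _); lra.
apply: le_trans (ler_wpM2l (ltW th0) sq).
have : 4 / (r ^+ 2 * th) <= j%:R by apply: ltW; exact: truncnS_gt.
rewrite ler_pdivrMr ?mulr_gt0 ?exprn_gt0// => h.
have := ler_wpM2l (ltW jR) h; nra.
Qed.

Lemma indic_pred (R : realType) (T : Type) (b : T -> bool) (x : T) :
  \1_[set x | b x] x = (b x)%:R :> R.
Proof.
rewrite indicE; case: (boolP (b x)) => bx; first by rewrite mem_set.
by rewrite memNset//=; exact/negP.
Qed.

Lemma cvge0_eventually_le (R : realType) (u : nat -> \bar R) :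
  (forall n, (0 <= u n)%E) ->
  (forall e : R, 0 < e -> \forall n \near \oo, (u n <= e%:E)%E) ->
  u n @[n --> \oo] --> 0%E.
Proof.
move=> u0 ue; apply/fine_cvgP; split.
  near=> n; rewrite ge0_fin_numE// (@le_lt_trans _ _ 1%:E) ?ltry//.
  by near: n; exact: ue.
apply/cvgrPdist_le => e e0; near=> n.
have un : (u n <= e%:E)%E by near: n; exact: ue.
rewrite sub0r normrN ger0_norm ?fine_ge0//.
rewrite -lee_fin fineK// ge0_fin_numE// (le_lt_trans un)// ltry.
Unshelve. all: by end_near. Qed.

Lemma fine_near_le (R : realType) (u : nat -> \bar R) (e : R) :
  u n @[n --> \oo] --> 0%E -> 0 < e -> \forall n \near \oo, (u n <= e%:E)%E.
Proof.
move=> /fine_cvgP[fu /cvgrPdist_le/(_ e) cu] e0; near=> n.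
have un : u n \is a fin_num by near: n.
rewrite -(fineK un) lee_fin; apply: le_trans (ler_norm _) _.
rewrite -normrN -sub0r; near: n; exact: cu.
Unshelve. all: by end_near. Qed.

(** Young's inequality turns a bound on a sum of absolute values into one on
    second moments, to which Markov's inequality applies directly. *)
Lemma sum_abs_le_sqr (R : realType) (I : finType) (u : I -> R) (q : R) : 0 < q ->
  \sum_i `|u i| <= #|I|%:R / (4 * q) * (\sum_i u i ^+ 2) + q.
Proof.
move=> q0; have [I0|I0] := posnP #|I|.
  rewrite !big1 ?mulr0 ?add0r ?ltW// => i _.
    by have := fintype0 i I0.
  by have := fintype0 i I0.
have N0 : 0 < #|I|%:R :> R by rewrite ltr0n.
set N : R := #|I|%:R in N0 *.
have -> : N / (4 * q) * (\sum_i u i ^+ 2) + q =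
    \sum_i (N / (4 * q) * u i ^+ 2 + q / N).
  rewrite big_split /= -mulr_sumr sumr_const -[q / N *+ _]mulr_natr -/N.
  by rewrite divfK// gt_eqF.
apply: ler_sum => i _; rewrite -(real_normK (num_real (u i))).
set a := `|u i|.
rewrite -subr_ge0.
have -> : N / (4 * q) * a ^+ 2 + q / N - a = (N * a - 2 * q) ^+ 2 / (4 * q * N).
  by field; rewrite !gt_eqF.
by rewrite divr_ge0 ?sqr_ge0// !mulr_ge0// ltW.
Qed.

(** * Integrating out one observation given the past *)

Section Conditioning.
Local Open Scope ereal_scope.
Context {R : realType}.

Import HBNNSimple.

Lemma integral_limn_approx d d' (T : measurableType d) (S : measurableType d')
    (mu : {measure set T -> \bar R}) (p : T -> S) (f : S -> \bar R)
    (h : T -> \bar R) (mf : measurable_fun setT f) :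
  measurable_fun setT p -> (forall s, 0 <= f s) ->
  measurable_fun setT h -> (forall x, 0 <= h x) -> (forall x, h x \is a fin_num) ->
  \int[mu]_x (f (p x) * h x) =
  limn (fun n => \int[mu]_x ((nnsfun_approx measurableT mf n (p x))%:E * h x)).
Proof.
move=> mp f0 mh h0 hfin.
rewrite -monotone_convergence//=.
- apply: eq_integral => x _; apply/esym/cvg_lim => //.
  apply: cvgeZr => //.
  exact: (@cvg_nnsfun_approx _ _ _ _ measurableT _ mf (fun s _ => f0 s)).
- move=> n; apply: emeasurable_funM => //.
  exact/measurable_EFinP/measurableT_comp.
- by move=> n x _; rewrite mule_ge0// lee_fin.
- move=> x _ a b ab; rewrite lee_wpmul2r// lee_fin.
  exact/lefP/nd_nnsfun_approx.
Qed.

Lemma integral_nnsfun_weight d d' (T : measurableType d) (S : measurableType d')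
    (mu : {measure set T -> \bar R}) (p : T -> S) (f : {nnsfun S >-> R})
    (h : T -> \bar R) :
  measurable_fun setT p -> measurable_fun setT h -> (forall x, 0 <= h x) ->
  \int[mu]_x ((f (p x))%:E * h x) =
  \sum_(r \in range f) (r%:E * \int[mu]_(x in p @^-1` (f @^-1` [set r])) h x).
Proof.
move=> mp mh h0.
have mA r : measurable (p @^-1` (f @^-1` [set r])).
  by rewrite -[X in measurable X]setTI; apply: mp.
have E x : (f (p x))%:E * h x =
  \sum_(r \in range f) (r%:E * (\1_(f @^-1` [set r]) (p x))%:E * h x).
  rewrite fimfunE -fsumEFin// ge0_mule_fsuml//.
  by move=> r; rewrite EFinM nnfun_muleindic_ge0.
under eq_integral do rewrite E.
rewrite ge0_integral_fsum//.
- apply: eq_fsbigr => r; rewrite inE => -[s _ fs].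
  under eq_integral do rewrite -muleA.
  rewrite ge0_integralZl//.
  + congr (_ * _); rewrite [RHS]integral_mkcond; apply: eq_integral => x _.
    by rewrite epatch_indic muleC.
  + apply: emeasurable_funM => //; apply/measurable_EFinP.
    by apply: measurableT_comp.
  + by move=> x _; rewrite mule_ge0// lee_fin.
  + by rewrite lee_fin -fs.
- move=> r; apply: emeasurable_funM => //; apply: emeasurable_funM => //.
  by apply/measurable_EFinP; apply: measurableT_comp.
- by move=> r x _; rewrite mule_ge0// nnfun_muleindic_ge0.
Qed.

(** Both integrals are limits of the same combinations of integrals over events
    of the form [p @^-1` B].  The map [p] will be the identity of [T], seen as
    valued in [T] with a smaller sigma-algebra, so that measurability of [f]
    becomes measurability with respect to the past. *)
Lemma eq_integral_weight d d' (T : measurableType d) (S : measurableType d')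
    (mu : {measure set T -> \bar R}) (p : T -> S) (f : S -> \bar R)
    (h k : T -> \bar R) :
  measurable_fun setT p -> measurable_fun setT f -> (forall s, 0 <= f s) ->
  measurable_fun setT h -> (forall x, 0 <= h x) -> (forall x, h x \is a fin_num) ->
  measurable_fun setT k -> (forall x, 0 <= k x) -> (forall x, k x \is a fin_num) ->
  (forall B, measurable B ->
     \int[mu]_(x in p @^-1` B) h x = \int[mu]_(x in p @^-1` B) k x) ->
  \int[mu]_x (f (p x) * h x) = \int[mu]_x (f (p x) * k x).
Proof.
move=> mp mf f0 mh h0 hfin mk k0 kfin hk.
rewrite !(integral_limn_approx _ mf)//; congr (limn _); apply/funext => n.
rewrite !integral_nnsfun_weight//; apply: eq_fsbigr => r _.
by rewrite hk.
Qed.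

(** Disintegration: the definition of a conditional law only speaks of events,
    and this extends it to integrands that depend on the past and on [X]. *)
Lemma conditional_law_integral d (T : measurableType d) (P : probability T R)
    (G : set (set T)) (X : T -> nat) (kappa : T -> set nat -> \bar R)
    (f : nat -> T -> \bar R) :
  sigma_algebra setT G -> G `<=` measurable -> measurable_fun setT X ->
  (forall x B, 0 <= kappa x B) -> (forall x B, kappa x B \is a fin_num) ->
  conditional_law P G X kappa ->
  (forall y x, 0 <= f y x) ->
  (forall y, measurable_fun setT (f y : g_sigma_algebraType G -> \bar R)) ->
  \int[P]_x f (X x) x = \int[P]_x \sum_(y <oo) (f y x * kappa x [set y]).
Proof.
move=> sG GT mX k0 kfin [mkappa law] f0 mf.
have mid : measurable_fun setT (id : T -> g_sigma_algebraType G).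
  move=> _ B mB; rewrite setTI; apply: GT.
  by rewrite -(measurable_g_measurableTypeE sG).
have mXy y : measurable (X @^-1` [set y]).
  by rewrite -[X in measurable X]setTI; apply: mX.
have mfT y : measurable_fun setT (f y) by exact: measurableT_comp (mf y) mid.
have mk y : measurable_fun setT (fun x => kappa x [set y]).
  by apply: measurableT_comp (mkappa [set y] _) mid.
have step y : \int[P]_x (f y x * (\1_(X @^-1` [set y]) x)%:E) =
    \int[P]_x (f y x * kappa x [set y]).
  apply: (@eq_integral_weight _ _ _ (g_sigma_algebraType G) P id (f y)) => //.
  - by apply/measurable_EFinP; apply: measurable_indic.
  move=> B; rewrite measurable_g_measurableTypeE// => GB.
  rewrite integral_indic//; last exact: GT.
  by rewrite setIC -law.
have -> : \int[P]_x f (X x) x =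
    \int[P]_x \sum_(y <oo) (f y x * (\1_(X @^-1` [set y]) x)%:E).
  apply: eq_integral => x _.
  rewrite (@nneseriesD1 _ _ (X x))//; last first.
    by move=> k _; rewrite mule_ge0// lee_fin.
  rewrite indicE mem_set//= mule1 eseries0 ?adde0// => k _ /= kX.
  by rewrite indicE memNset ?mule0// => /= Xk; move: kX; rewrite -Xk eqxx.
rewrite !integral_nneseries//.
- by apply: eq_eseriesr => y _; exact: step.
- by move=> y; apply: emeasurable_funM.
- by move=> y x _; rewrite mule_ge0.
- move=> y; apply: emeasurable_funM => //.
  by apply/measurable_EFinP; apply: measurable_indic.
- by move=> y x _; rewrite mule_ge0// lee_fin.
Qed.

Lemma markov_ge0 d (T : measurableType d) (P : probability T R) (f : T -> R)
    (r : R) : (0 < r)%R -> (forall x, 0 <= f x)%R ->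
  measurable_fun setT f ->
  r%:E * P [set x | r <= f x]%R <= \int[P]_x (f x)%:E.
Proof.
move=> r0 f0 mf.
set A := [set x | _]; have mA : measurable A.
  rewrite -[X in measurable X]setTI; exact: measurable_fun_le.
rewrite (_ : P A = \int[P]_x (\1_A x)%:E); last by rewrite integral_indic// setIT.
rewrite -ge0_integralZl//.
- apply: ge0_le_integral => //.
  + by move=> x _; rewrite mule_ge0// lee_fin ltW.
  + by apply: measurable_funeM; apply/measurable_EFinP; exact: measurable_indic.
  + exact/measurable_EFinP.
  move=> x _; rewrite -EFinM lee_fin indicE.
  by case: (boolP (x \in A)) => [/[1!inE]/= rf|_]; rewrite ?mulr1// mulr0.
- by apply/measurable_EFinP; exact: measurable_indic.
- by rewrite lee_fin ltW.
Qed.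

End Conditioning.

(** * The Poisson law *)

Section Poisson.
Local Open Scope ereal_scope.
Context {R : realType}.

Lemma poisson_lawE (mu : R) y : (0 < mu)%R ->
  poisson_law mu [set y] = (poisson_pmf mu y)%:E.
Proof.
move=> mu0; rewrite /poisson_law /poisson_prob mu0 esum_set1//.
by rewrite lee_fin poisson_pmf_ge0.
Qed.

Lemma poisson_law_set0 (mu : R) : (0 < mu)%R ->
  poisson_law mu [set 0%N] = (expR (- mu))%:E.
Proof.
by move=> mu0; rewrite poisson_lawE// /poisson_pmf mu0 expr0 fact0 invr1 !mul1r.
Qed.

Lemma poisson_total (mu : R) : (0 < mu)%R ->
  \sum_(y <oo) (poisson_pmf mu y)%:E = 1.
Proof.
move=> mu0; rewrite nneseries_esumT; last first.
  by move=> y; rewrite lee_fin poisson_pmf_ge0.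
by have : poisson_prob mu 0 setT = 1 := probability_setT _; rewrite /poisson_prob mu0.
Qed.

(** The Chen-Stein identity, from [y * p y = mu * p (y - 1)] for the Poisson
    weights [p]; the choices [f = 1] and [f y = y + 1] give the first two
    moments. *)
Lemma poisson_stein (mu : R) (f : nat -> R) :
  (0 < mu)%R -> (forall y, 0 <= f y)%R ->
  \sum_(y <oo) (y%:R * f y.-1 * poisson_pmf mu y)%:E =
  mu%:E * \sum_(y <oo) (f y * poisson_pmf mu y)%:E.
Proof.
move=> mu0 f0; have p0 y := poisson_pmf_ge0 mu y.
rewrite nneseries_recl//; last by move=> y _; rewrite lee_fin !mulr_ge0.
rewrite !mul0r add0e -(nneseries_addn 1); last first.
  by move=> y; rewrite lee_fin !mulr_ge0.
rewrite -nneseriesZl; last by move=> y _; rewrite lee_fin mulr_ge0.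
apply: eq_eseriesr => y _; rewrite -EFinM addn1/=; congr EFin.
rewrite /poisson_pmf mu0 exprS factS natrM invfM.
have y0 : (y.+1%:R != 0 :> R)%R by rewrite pnatr_eq0.
have yf0 : (y`!%:R != 0 :> R)%R by rewrite pnatr_eq0 -lt0n fact_gt0.
by move: y0 yf0; move: (y.+1%:R)%R (y`!%:R)%R => u v u0 v0; field; rewrite u0 v0.
Qed.

Lemma poisson_mean (mu : R) : (0 < mu)%R ->
  \sum_(y <oo) (y%:R * poisson_pmf mu y)%:E = mu%:E.
Proof.
move=> mu0; have := @poisson_stein mu (fun=> 1%R) mu0 (fun=> ler01).
under eq_eseriesr do rewrite mulr1; move=> ->.
by under eq_eseriesr do rewrite mul1r; rewrite poisson_total// mule1.
Qed.

Lemma poisson_second_moment (mu : R) : (0 < mu)%R ->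
  \sum_(y <oo) (y%:R ^+ 2 * poisson_pmf mu y)%:E = (mu * (mu + 1))%:E.
Proof.
move=> mu0; have p0 y := poisson_pmf_ge0 mu y.
have := @poisson_stein mu (fun y => y%:R + 1)%R mu0
  (fun y => addr_ge0 (ler0n _ y) ler01).
have -> : \sum_(y <oo) (y%:R * (y.-1%:R + 1) * poisson_pmf mu y)%:E =
    \sum_(y <oo) (y%:R ^+ 2 * poisson_pmf mu y)%:E.
  apply: eq_eseriesr => -[|y] _; first by rewrite expr2 !mul0r.
  by rewrite /= natr1 -expr2.
move=> ->; rewrite EFinM; congr (_ * _).
under eq_eseriesr do rewrite mulrDl mul1r EFinD.
rewrite nneseriesD ?poisson_mean ?poisson_total// => y _ _.
  by rewrite lee_fin mulr_ge0.
by rewrite lee_fin.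
Qed.

(** Keeping [a] and [b] together makes this a statement about nonnegative
    integrands, so that a martingale increment can be integrated without any a
    priori integrability. *)
Lemma poisson_quadratic (mu a b : R) : (0 < mu)%R ->
  \sum_(y <oo) ((a + b * (y%:R - mu)) ^+ 2 * poisson_pmf mu y)%:E =
  (a ^+ 2 + b ^+ 2 * mu)%:E.
Proof.
move=> mu0; have p0 y := poisson_pmf_ge0 mu y.
pose c := (a - b * mu)%R; pose e := (2 * `|c * b|)%R.
(* Adding [e * y] makes the linear term of the expanded square nonnegative, so
   that the series can be split. *)
have e0 : (0 <= e)%R by rewrite mulr_ge0.
have ce0 : (0 <= 2 * (c * b) + e)%R.
  by have := ler_norm (- (c * b)); rewrite normrN /e; lra.
have E y : ((a + b * (y%:R - mu)) ^+ 2 * poisson_pmf mu y)%:E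
    + e%:E * (y%:R * poisson_pmf mu y)%:E =
  (c ^+ 2)%:E * (poisson_pmf mu y)%:E
    + ((b ^+ 2)%:E * (y%:R ^+ 2 * poisson_pmf mu y)%:E
    + (2 * (c * b) + e)%:E * (y%:R * poisson_pmf mu y)%:E).
  by rewrite -!EFinM -!EFinD; congr EFin; rewrite /c; ring.
have := eq_eseriesr (P := xpredT) (N := 0) (fun y _ => E y).
rewrite !nneseriesD; last first; try by move=> y _ _; rewrite -?EFinM -?EFinD lee_fin;
  do ?[done | exact: sqr_ge0 | apply: addr_ge0 | apply: mulr_ge0].
rewrite !nneseriesZl; last first; try by move=> y _; rewrite lee_fin;
  do ?[done | exact: sqr_ge0 | apply: mulr_ge0].
rewrite poisson_mean// poisson_total// poisson_second_moment// -!EFinM -!EFinD.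
case: (\sum_(y <oo) _)%E => [r||]; [|by rewrite addye|by rewrite addNye].
by rewrite -EFinD => -[E']; congr EFin; rewrite -[LHS](addrK (e * mu)%R) E' /c; ring.
Qed.

End Poisson.

(** * The history and the recursion *)

Section Step.
Context {R : realType}.

Definition glarma_step (beta0 gamma1 w : R) (y : nat) : R :=
  beta0 + gamma1 * (y%:R * expR (- w) - 1).

Lemma glarma_errorE (w : R) y : glarma_error w y = y%:R * expR (- w) - 1.
Proof. by rewrite /glarma_error expRN mulrBl mulfV// gt_eqF// expR_gt0. Qed.

Lemma measurable_of_nat d (T : measurableType d) d' (S : measurableType d')
    (f : nat -> S) (y : T -> nat) :
  measurable_fun setT y -> measurable_fun setT (fun x => f (y x)).
Proof.
move=> my _ B _; rewrite (_ : _ @^-1` _ = y @^-1` (f @^-1` B))//; exact: my.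
Qed.

Lemma measurable_glarma_step d (T : measurableType d) (beta0 gamma1 : R)
    (w : T -> R) (y : T -> nat) :
  measurable_fun setT w -> measurable_fun setT y ->
  measurable_fun setT (fun x => glarma_step beta0 gamma1 (w x) (y x)).
Proof.
move=> mw my; apply: measurable_funD => //; apply: measurable_funM => //.
apply: measurable_funD => //; apply: measurable_funM.
  exact: (measurable_of_nat (fun n => n%:R : R)).
by apply: measurableT_comp => //; apply: measurableT_comp.
Qed.

End Step.

Section History.
Context {R : realType} d (T : measurableType d) (P : probability T R).
Variables (beta0 gamma1 : R) (Y : nat -> {RV P >-> nat}) (W : nat -> {RV P >-> R}).
Hypothesis model : glarma_model P beta0 gamma1 Y W.

Local Notation history t := (glarma_history Y W t).
Local Notation past t := (g_sigma_algebraType (glarma_history Y W t)).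
Local Notation mu t x := (expR (W t x)).

Lemma W_step t x : (1 <= t)%N ->
  W t.+1 x = glarma_step beta0 gamma1 (W t x) (Y t x).
Proof. by move=> t1; rewrite model.2// glarma_errorE. Qed.

Lemma sigma_algebra_history t : sigma_algebra setT (history t).
Proof. exact: smallest_sigma_algebra. Qed.

Lemma history_measurable t : history t `<=` measurable.
Proof.
apply: smallest_sub; first exact: sigma_algebra_measurable.
rewrite subUset; split => [A [B mB <-]|]; first exact: measurable_funPT.
by apply: bigcup_sub => s _ A [B mB <-]; exact: measurable_funPT.
Qed.

Lemma history_measurableE t (A : set T) :
  measurable (A : set (past t)) = history t A.
Proof. by rewrite measurable_g_measurableTypeE//; exact: sigma_algebra_history. Qed.

Lemma measurable_past d' (S : measurableType d') t (f : T -> S) :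
  measurable_fun setT (f : past t -> S) -> measurable_fun setT f.
Proof.
move=> mf _ B mB; apply: (@history_measurable t).
by rewrite -history_measurableE; exact: mf.
Qed.

Lemma measurable_pastS d' (S : measurableType d') s t (f : T -> S) : (s <= t)%N ->
  measurable_fun setT (f : past s -> S) -> measurable_fun setT (f : past t -> S).
Proof.
move=> st mf _ B mB; rewrite history_measurableE.
have : history s ([set: T] `&` f @^-1` B) by rewrite -history_measurableE; exact: mf.
apply: sub_sigma_algebra2; apply: setUS; apply: bigcup_subset => u /= /andP[u1 us].
by rewrite u1 (leq_trans us).
Qed.

Lemma measurable_Y_past s t : (1 <= s < t)%N ->
  measurable_fun setT (Y s : past t -> nat).
Proof.
move=> st _ B mB; rewrite history_measurableE; apply: sub_sigma_algebra.
by right; exists s => //; exists B.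
Qed.

Lemma measurable_W_past t : (1 <= t)%N -> measurable_fun setT (W t : past t -> R).
Proof.
elim: t => // -[_ _|t IH _].
  move=> _ B mB; rewrite history_measurableE; apply: sub_sigma_algebra.
  by left; exists B.
have -> : (W t.+2 : T -> R) =
    (fun x => glarma_step beta0 gamma1 (W t.+1 x) (Y t.+1 x)).
  by apply/funext => x; rewrite W_step.
apply: (@measurable_glarma_step _ _ (past t.+2)).
  by apply: (measurable_pastS (leqnSn _)); exact: IH.
by apply: measurable_Y_past; rewrite /= ltnSn.
Qed.

Local Open Scope ereal_scope.

Lemma integral_Y_past t (f : nat -> T -> R) : (1 <= t)%N ->
  (forall y x, 0 <= f y x)%R ->
  (forall y, measurable_fun setT (f y : past t -> R)) ->
  \int[P]_x (f (Y t x) x)%:E =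
  \int[P]_x \sum_(y <oo) (f y x * poisson_pmf (mu t x) y)%:E.
Proof.
move=> t1 f0 mf.
have law := model.1 t t1.
rewrite (conditional_law_integral (f := fun y x => (f y x)%:E) _ _ _ _ _ law).
- apply: eq_integral => x _; apply: eq_eseriesr => y _.
  by rewrite poisson_lawE ?expR_gt0// EFinM.
- exact: sigma_algebra_history.
- exact: history_measurable.
- by [].
- by move=> x B; exact: (measure_ge0 (poisson_prob (mu t x) 0)).
- by move=> x B; exact: (fin_num_measure (poisson_prob (mu t x) 0)).
- by move=> y x; rewrite lee_fin.
- by move=> y; apply/measurable_EFinP; exact: mf.
Qed.

Lemma integral_Y_linear t (b : T -> R) : (1 <= t)%N -> (forall x, 0 <= b x)%R ->
  measurable_fun setT (b : past t -> R) ->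
  \int[P]_x (b x * (Y t x)%:R)%:E = \int[P]_x (b x * mu t x)%:E.
Proof.
move=> t1 b0 mb; rewrite (@integral_Y_past t (fun y x => b x * y%:R)%R)//.
- apply: eq_integral => x _; under eq_eseriesr do rewrite -mulrA EFinM.
  rewrite nneseriesZl ?poisson_mean ?expR_gt0// => y _.
  by rewrite lee_fin mulr_ge0// poisson_pmf_ge0.
- by move=> y x; rewrite mulr_ge0.
- by move=> y; apply: (measurable_funM mb).
Qed.

Lemma integral_Y_quadratic t (a b : T -> R) : (1 <= t)%N ->
  measurable_fun setT (a : past t -> R) -> measurable_fun setT (b : past t -> R) ->
  \int[P]_x ((a x + b x * ((Y t x)%:R - mu t x)) ^+ 2)%:E =
  \int[P]_x (a x ^+ 2 + b x ^+ 2 * mu t x)%:E.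
Proof.
move=> t1 ma mb.
rewrite (@integral_Y_past t (fun y x => (a x + b x * (y%:R - mu t x)) ^+ 2)%R)//.
- by apply: eq_integral => x _; rewrite poisson_quadratic ?expR_gt0.
- by move=> y x; exact: sqr_ge0.
- move=> y; apply: (@measurable_funX _ (past t)); apply: measurable_funD => //.
  apply: measurable_funM => //; apply: measurable_funB => //.
  by apply: measurableT_comp => //; exact: measurable_W_past.
Qed.

Lemma integral_indic_past t (A : set T) : history t A ->
  \int[P]_x (\1_A x)%:E = P A.
Proof.
by move=> /history_measurable mA; rewrite integral_indic// setIT.
Qed.

Lemma measurable_indic_past t (A : set T) : history t A ->
  measurable_fun setT (\1_A : past t -> R).
Proof. by move=> HA; apply: measurable_indic; rewrite history_measurableE. Qed.

(** Conditionally on the past, [Y_t exp(- W_t)] has mean one; this is Markov's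
    inequality for it on an event of the past. *)
Lemma ratio_tail t (A : set T) (r : R) : (1 <= t)%N -> history t A -> (0 < r)%R ->
  r%:E * P (A `&` [set x | r <= (Y t x)%:R * expR (- W t x)]%R) <= P A.
Proof.
move=> t1 HA r0.
have mAt := measurable_indic_past HA.
have mWt := measurable_W_past t1.
have meW : measurable_fun setT (fun x => expR (- W t x) : R).
  by apply: measurableT_comp => //; apply: measurableT_comp.
have mb : measurable_fun setT ((fun x => \1_A x * expR (- W t x))%R : past t -> R).
  apply: measurable_funM => //; apply: measurableT_comp => //.
  exact: measurableT_comp.
have := @markov_ge0 _ _ _ P (fun x => \1_A x * expR (- W t x) * (Y t x)%:R)%R r r0.
rewrite (integral_Y_linear t1 _ mb); last by move=> x; rewrite mulr_ge0// expR_ge0.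
under eq_integral do rewrite -mulrA -expRD addNr expR0 mulr1.
rewrite (integral_indic_past HA) => mk.
apply: le_trans (mk _ _); last 2 first.
- by move=> x; rewrite !mulr_ge0// expR_ge0.
- apply: measurable_funM; first exact: measurable_past mb.
  exact: (measurable_of_nat (fun n => n%:R : R)).
apply: lee_wpmul2l; first by rewrite lee_fin ltW.
have E : A `&` [set x | r <= (Y t x)%:R * expR (- W t x)]%R =
         [set x | r <= \1_A x * expR (- W t x) * (Y t x)%:R]%R.
  apply/seteqP; split => x /=.
    by move=> [Ax rx]; rewrite indicE mem_set// mul1r mulrC.
  rewrite indicE; case: (boolP (x \in A)) => [/[1!inE] Ax|_]; rewrite ?mul1r 1?mulrC//.
  by rewrite mul0r mulr0 => /(lt_le_trans r0); rewrite ltxx.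
by rewrite E.
Qed.

End History.

(** * Frequency of zeros, tightness, martingale bounds *)

Section Zeros.
Context {R : realType} d (T : measurableType d) (P : probability T R).
Variables (beta0 gamma1 : R) (Y : nat -> {RV P >-> nat}) (W : nat -> {RV P >-> R}).
Hypothesis model : glarma_model P beta0 gamma1 Y W.

Local Notation history t := (glarma_history Y W t).
Local Notation past t := (g_sigma_algebraType (glarma_history Y W t)).
Local Notation mu t x := (expR (W t x)).

Lemma glarma_step_le (g w r : R) y : y%:R * expR (- w) <= r ->
  glarma_step beta0 g w y <= beta0 + `|g| * (1 + r).
Proof.
move=> yr; rewrite lerD2l; apply: le_trans (ler_norm _) _.
rewrite normrM ler_wpM2l// (le_trans (ler_normB _ _))// normr1 addrC lerD2l.
by rewrite ger0_norm// mulr_ge0// expR_ge0.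
Qed.

Lemma history_preimage s t (B : set nat) : (1 <= s < t)%N -> history t (Y s @^-1` B).
Proof.
move=> st; rewrite -history_measurableE -[_ @^-1` _]setTI.
exact: (measurable_Y_past st).
Qed.

Lemma history_setI t (A B : set T) : history t A -> history t B -> history t (A `&` B).
Proof. by rewrite -!history_measurableE; exact: measurableI. Qed.

Lemma historyS s t (A : set T) : (s <= t)%N -> history s A -> history t A.
Proof.
move=> st; apply: sub_sigma_algebra2; apply: setUS.
apply: bigcup_subset => u /= /andP[u1 us].
by rewrite u1 (leq_trans us).
Qed.

Local Open Scope ereal_scope.

Lemma zero_ge t (A : set T) (M : R) : (1 <= t)%N -> history t A ->
  (forall x, A x -> W t x <= M)%R ->
  (expR (- expR M))%:E * P A <= P (A `&` Y t @^-1` [set 0%N]).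
Proof.
move=> t1 HA AM; have mA := history_measurable HA.
rewrite (model.1 t t1).2//.
have -> : (expR (- expR M))%:E * P A = \int[P]_(x in A) (expR (- expR M))%:E.
  by rewrite integral_cst.
apply: ge0_le_integral => //.
- by apply: measurable_funTS; exact: (measurable_past ((model.1 t t1).1 _ _)).
- move=> x Ax; rewrite poisson_law_set0 ?expR_gt0// lee_fin ler_expR lerN2 ler_expR.
  exact: AM.
Qed.

(** The factor [1 / 2] is Markov's bound for [Y_t exp(- W_t) < 2], and the
    inner exponential is the largest mean that [Y_(t+1)] can then have. *)
Definition zero_rate : R := (expR (- expR (beta0 + `|gamma1| * (1 + 2))) / 2)%R.

Lemma zero_rate_itv : (0 < zero_rate < 1)%R.
Proof.
have h : (0 < expR (- expR (beta0 + `|gamma1| * (1 + 2))))%R by exact: expR_gt0.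
have h1 : (expR (- expR (beta0 + `|gamma1| * (1 + 2))) <= 1)%R.
  by rewrite -expR0 ler_expR oppr_le0 expR_ge0.
rewrite /zero_rate; lra.
Qed.

(** The bound is uniform in the past although [W_t] is unbounded: one step of
    the recursion brings [W_(t+1)] back below a constant with conditional
    probability at least one half. *)
Lemma nonzero_decay t (A : set T) : (1 <= t)%N -> history t A ->
  P (A `&` [set x | Y t.+1 x != 0%N]) <= (1 - zero_rate)%:E * P A.
Proof.
move=> t1 HA; have mA := history_measurable HA.
(* Off [V] the recursion bounds [W_(t+1)], so that [zero_ge] applies. *)
pose V : set T := [set x | 2 <= (Y t x)%:R * expR (- W t x)]%R.
have HV : history t.+1 V.
  rewrite -history_measurableE -[V]setTI; apply: measurable_fun_le => //.
  apply: measurable_funM.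
    apply: (measurable_of_nat (fun n => n%:R : R)).
    by apply: measurable_Y_past; rewrite t1 /=.
  apply: measurableT_comp => //; apply: measurableT_comp => //.
  by apply: (measurable_pastS (leqnSn t)); exact: (measurable_W_past model).
have HVc : history t.+1 (~` V).
  by move: HV; rewrite -!history_measurableE; exact: measurableC.
have mV := history_measurable HV; have mVc := history_measurable HVc.
have HAt : history t.+1 A := historyS (leqnSn t) HA.
set N := [set x | _].
have mN : measurable N.
  have -> : N = Y t.+1 @^-1` [set n | n != 0%N] by [].
  by rewrite -[X in measurable X]setTI; exact: measurable_funP.
have mZ : measurable (Y t.+1 @^-1` [set 0%N]).
  by rewrite -[X in measurable X]setTI; exact: measurable_funP.
have tail := @ratio_tail _ _ _ _ _ _ _ _ model t A 2%R t1 HA (ltr0Sn _ 1).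
have low : (expR (- expR (beta0 + `|gamma1| * (1 + 2))))%:E * P (A `&` ~` V) <=
   P (A `&` ~` V `&` Y t.+1 @^-1` [set 0%N]).
  apply: zero_ge => //; first exact: history_setI.
  move=> x [_ /= /negP]; rewrite -ltNge => /ltW Vx.
  by rewrite (W_step model)//; exact: glarma_step_le.
have low2 : P (A `&` ~` V `&` Y t.+1 @^-1` [set 0%N]) <= P (A `&` ~` N).
  apply: le_measure; rewrite ?inE.
  - by do 2 apply: measurableI => //.
  - by apply: measurableI => //; exact: measurableC.
  by move=> x [[Ax _] /= Y0]; split => //; rewrite /N /= Y0.
have PV : P A = P (A `&` V) + P (A `&` ~` V).
  by rewrite -measureU//; [rewrite -setIUr setUv setIT|exact: measurableI|
    exact: measurableI|rewrite setIACA setICr setI0].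
have PN : P A = P (A `&` N) + P (A `&` ~` N).
  by rewrite -measureU//; [rewrite -setIUr setUv setIT|exact: measurableI|
    apply: measurableI => //; exact: measurableC|rewrite setIACA setICr setI0].
move: tail low low2 PV PN; rewrite -/V.
have fin B : measurable B -> P B = (fine (P B))%:E.
  by move=> mB; rewrite fineK// fin_num_measure.
rewrite (fin A)// (fin (A `&` V)); last exact: measurableI.
rewrite (fin (A `&` ~` V)); last exact: measurableI.
rewrite (fin (A `&` N)); last exact: measurableI.
rewrite (fin (A `&` ~` N)); last by apply: measurableI => //; exact: measurableC.
rewrite (fin (A `&` ~` V `&` _)); last by do 2 apply: measurableI => //.
rewrite -!EFinM -!EFinD !lee_fin /zero_rate => tail low low2 [PV] [PN].
set e := expR _ in low *; have e0 : (0 < e)%R by exact: expR_gt0.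
nra.
Qed.

Definition nozero s l : set T := [set x | forall i, (s <= i < s + l)%N -> Y i x != 0%N].

Lemma history_nozero s l : (1 <= s)%N -> history (s + l) (nozero s l).
Proof.
move=> s1.
have -> : nozero s l =
    \bigcap_(i in [set i | (s <= i < s + l)%N]) (Y i @^-1` [set n | n != 0%N]) by [].
rewrite -history_measurableE; apply: bigcap_measurableType => i /= /andP[si isl].
by rewrite history_measurableE; apply: history_preimage; rewrite isl (leq_trans s1).
Qed.

Lemma measurable_nozero s l : (1 <= s)%N -> measurable (nozero s l).
Proof. move=> s1; have Hn := @history_nozero s l s1; exact: history_measurable Hn. Qed.

(** Two time steps are used for each factor: one to bring [W] down, one to
    observe a zero. *)
Lemma nozero_le s j : (1 <= s)%N ->
  P (nozero s j.*2) <= ((1 - zero_rate) ^+ j)%:E.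
Proof.
move=> s1; have /andP[k0 k1] := zero_rate_itv; elim: j => [|j IH].
  by rewrite expr0; apply: probability_le1; exact: measurable_nozero.
have t1 : (1 <= s + j.*2)%N by rewrite (leq_trans s1)// leq_addr.
apply: (@le_trans _ _ (P (nozero s j.*2 `&` [set x | Y (s + j.*2).+1 x != 0%N]))).
  apply: le_measure; rewrite ?inE.
  - exact: measurable_nozero.
  - apply: measurableI; first exact: measurable_nozero.
    have -> : [set x | Y (s + j.*2).+1 x != 0%N] =
      Y (s + j.*2).+1 @^-1` [set n | n != 0%N] by [].
    by rewrite -[X in measurable X]setTI; exact: measurable_funP.
  move=> x /= nz; split => /= [i /andP[si isl]|]; apply: nz; lia.
have dec := nonzero_decay t1 (@history_nozero s j.*2 s1).
apply: (le_trans dec).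
by rewrite exprS EFinM; apply: lee_wpmul2l => //; rewrite lee_fin; lra.
Qed.

(** Small ratios [Y_(s-1) exp(- W_(s-1))] and [Y_s exp(- W_s)] bound first
    [W_s] and then [Y_s].  The bound starts at [s = 2] because [W_1] does not
    come out of the recursion. *)
Lemma tail_Y (e : R) : (0 < e)%R -> exists2 m, (0 < m)%N & forall s, (2 <= s)%N ->
  P [set x | (m <= Y s x)%N] <= e%:E.
Proof.
move=> e0; pose r := (2 / e)%R; have r0 : (0 < r)%R by rewrite divr_gt0.
pose M := (beta0 + `|gamma1| * (1 + r))%R.
exists (Num.truncn (r * expR M)).+1 => // -[//|[//|s]] _.
pose A t := [set x | r <= (Y t x)%:R * expR (- W t x)]%R.
have mA t : measurable (A t).
  rewrite -[A t]setTI; apply: measurable_fun_le => //.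
  apply: measurable_funM; first exact: (measurable_of_nat (fun n => n%:R : R)).
  by apply: measurableT_comp => //; apply: measurableT_comp.
have PA t : (1 <= t)%N -> P (A t) <= (e / 2)%:E.
  move=> t1; have HT : history t setT.
    by rewrite -history_measurableE; exact: measurableT.
  have := ratio_tail model t1 HT r0; rewrite setTI probability_setT -/(A t).
  rewrite -(fineK (fin_num_measure P _ (mA t))) -EFinM !lee_fin.
  by rewrite -ler_pdivlMl// mulr1 invf_div.
apply: (@le_trans _ _ (P (A s.+1 `|` A s.+2))); last first.
  apply: le_trans (measureU2 _ _ _) _ => //.
  by rewrite [e]splitr EFinD; apply: leeD; exact: PA.
apply: le_measure; rewrite ?inE.
- have -> : [set x | ((Num.truncn (r * expR M)).+1 <= Y s.+2 x)%N] =
     Y s.+2 @^-1` [set n | ((Num.truncn (r * expR M)).+1 <= n)%N] by [].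
  by rewrite -[X in measurable X]setTI; exact: measurable_funP.
- exact: measurableU.
move=> x /= mY; have [|nA] := pselect (A s.+1 x); [by left|right].
have WM : (W s.+2 x <= M)%R.
  rewrite (W_step model)//; apply: glarma_step_le; apply: ltW.
  by rewrite ltNge; apply/negP.
rewrite /A /= expRN ler_pdivlMr ?expR_gt0//.
apply: (@le_trans _ _ (r * expR M)%R).
  by rewrite ler_wpM2l ?ler_expR// ltW.
by apply: (le_trans (ltW (truncnS_gt _))); rewrite ler_nat.
Qed.

Definition martingale_transform (c : nat -> T -> R) (n : nat) (x : T) : R :=
  (\sum_(1 <= t < n.+1) c t x * ((Y t x)%:R - mu t x))%R.

Lemma measurable_martingale_transform_past (c : nat -> T -> R) n :
  (forall t, (1 <= t)%N -> measurable_fun setT (c t : past t -> R)) ->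
  measurable_fun setT (martingale_transform c n : past n.+1 -> R).
Proof.
move=> mc.
have -> : martingale_transform c n = fun x => (\sum_(1 <= t < n.+1)
    if (1 <= t < n.+1)%N then c t x * ((Y t x)%:R - mu t x) else 0)%R.
  by apply/funext => x; apply: eq_big_nat => t ->.
apply: measurable_sum => t; case: (boolP (1 <= t < n.+1)%N) => // /andP[t1 tn].
apply: measurable_funM.
  by apply: (measurable_pastS (ltnW tn)); exact: mc.
apply: measurable_funB.
  apply: (measurable_of_nat (fun n => n%:R : R)).
  by apply: measurable_Y_past; rewrite t1.
apply: measurableT_comp => //; apply: (measurable_pastS (ltnW tn)).
exact: (measurable_W_past model t1).
Qed.

(** Orthogonality of the increments, in the form of [integral_Y_quadratic]
    applied with [a] the sum up to [n] and [b = c (n+1)]. *)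
Lemma martingale_transform_second_moment (c : nat -> T -> R) (C : R) n : (0 <= C)%R ->
  (forall t, (1 <= t)%N -> measurable_fun setT (c t : past t -> R)) ->
  (forall t x, (1 <= t)%N -> c t x ^+ 2 * mu t x <= C)%R ->
  \int[P]_x (martingale_transform c n x ^+ 2)%:E <= (n%:R * C)%:E.
Proof.
move=> C0 mc cC; elim: n => [|n IH].
  under eq_integral do rewrite /martingale_transform big_geq// expr2 mulr0.
  by rewrite integral0 mul0r.
under eq_integral do
  rewrite /martingale_transform big_nat_recr//= -/(martingale_transform c n _).
rewrite (integral_Y_quadratic model)//; last 2 first.
- exact: measurable_martingale_transform_past.
- exact: mc.
have mtr := measurable_past (@measurable_martingale_transform_past c n mc).
have mcn := measurable_past (mc n.+1 isT).
under eq_integral do rewrite EFinD.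
rewrite ge0_integralD//; last 4 first.
- by move=> x _; rewrite lee_fin sqr_ge0.
- by apply/measurable_EFinP; exact: measurable_funX.
- by move=> x _; rewrite lee_fin mulr_ge0 ?sqr_ge0 ?expR_ge0.
- apply/measurable_EFinP; apply: measurable_funM; first exact: measurable_funX.
  exact: measurableT_comp.
rewrite -natr1 mulrDl mul1r EFinD; apply: leeD => //.
apply: (@le_trans _ _ (\int[P]_x C%:E)).
  apply: ge0_le_integral => //.
  - by move=> x _; rewrite lee_fin mulr_ge0 ?sqr_ge0 ?expR_ge0.
  - apply/measurable_EFinP; apply: measurable_funM; first exact: measurable_funX.
    exact: measurableT_comp.
  - by move=> x _; rewrite lee_fin; exact: cC.
by rewrite integral_cst// (_ : _ [set: T] = 1) ?mule1//; exact: probability_setT.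
Qed.

(** The conditional variance of [Y_t] is [mu_t]: take [b = 1_A / sqrt mu_t] in
    [integral_Y_quadratic]. *)
Lemma integral_chi2 t (A : set T) : (1 <= t)%N -> history t A ->
  \int[P]_x (\1_A x * (((Y t x)%:R - mu t x) ^+ 2 / mu t x))%:E = P A.
Proof.
move=> t1 HA; rewrite -(integral_indic_past HA).
have mW := measurable_W_past model t1.
pose b x := (\1_A x * expR (- (W t x / 2)))%R.
have mb : measurable_fun setT (b : past t -> R).
  apply: measurable_funM; first exact: measurable_indic_past.
  apply: measurableT_comp => //; apply: measurableT_comp => //.
  exact: measurable_funM.
have b2 x : (b x ^+ 2 = \1_A x / mu t x)%R.
  rewrite /b exprMn -expRM_natl; congr (_ * _)%R.
    by rewrite indicE; case: (x \in A); rewrite ?expr1n ?expr0n.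
  by rewrite -expRN; congr expR; field.
have := @integral_Y_quadratic _ _ _ _ _ _ _ _ model t (cst 0%R) b t1
  (@measurable_cst _ _ _ _ _ _) mb.
under eq_integral do rewrite add0r exprMn b2.
under [RHS]eq_integral do rewrite expr0n add0r b2 mulfVK ?gt_eqF ?expR_gt0//.
move=> <-; apply: eq_integral => x _; congr EFin.
by rewrite mulrA mulrAC.
Qed.

End Zeros.

(** * The gain over the truth, and windows of observations *)

Section Gain.
Context {R : realType}.

Definition loglik (w : R) (y : nat) : R := y%:R * w - expR w.
Definition gain (w f : R) (y : nat) : R := loglik f y - loglik w y.
Definition chi2 (w : R) (y : nat) : R := (y%:R - expR w) ^+ 2 / expR w.

Lemma chi2_ge0 (w : R) y : 0 <= chi2 w y.
Proof. by rewrite divr_ge0 ?sqr_ge0 ?expR_ge0. Qed.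

(** For [y > 0] the gain is maximal at [f = ln y], where it is the Kullback
    term [y ln (y / mu) - y + mu], and [ln u <= u - 1] bounds it by the
    chi-square term. *)
Lemma gain_chi2 (w f : R) y : gain w f y <= chi2 w y.
Proof.
have mu0 := expR_gt0 w; rewrite /gain /loglik /chi2.
rewrite ler_pdivlMr//; case: y => [|y]; first by have := expR_gt0 f; nra.
set q : R := y.+1%:R; have q0 : 0 < q by rewrite ltr0n.
have qf : q * (1 + (f - ln q)) <= expR f.
  have -> : expR f = q * expR (f - ln q).
    by rewrite expRB lnK ?posrE// mulrC divfK ?gt_eqF.
  by rewrite ler_pM2l// expR_ge1Dx.
have lq : ln q - w <= q / expR w - 1.
  have -> : ln q - w = ln (q / expR w).
    by rewrite ln_div ?posrE// expRK.
  have := @le_ln1Dx R (q / expR w - 1); rewrite [1 + _]addrC subrK; apply.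
  by rewrite ltrBrDr addNr divr_gt0.
move: lq; rewrite lerBrDr ler_pdivlMr// => lq; move: mu0 lq.
move: (expR w) => mu mu0 lq.
have : q * f - expR f <= q * ln q - q by nra.
nra.
Qed.

Definition exp_excess (D : R) : R := expR D - 1 - D.

Lemma gainE (w f : R) y :
  gain w f y = (y%:R - expR w) * (f - w) - expR w * exp_excess (f - w).
Proof.
have -> : f = w + (f - w) by rewrite addrC subrK.
move: (f - w) => D; rewrite /gain /loglik /exp_excess expRD [w + D]addrC addrK; ring.
Qed.

Lemma exp_excess_ge0 (D : R) : 0 <= exp_excess D.
Proof. by have := expR_ge1Dx D; rewrite /exp_excess; lra. Qed.

(** For [D >= -2], [exp D >= (1 + D / 2)^2] gives the quadratic bound; for
    [D < -2] the linear term alone is at least one. *)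
Lemma exp_excess_ge (e D : R) : 0 < e -> e <= `|D| ->
  Num.min (e ^+ 2 / 4) 1 <= exp_excess D.
Proof.
move=> e0 eD; have e2 : e ^+ 2 <= D ^+ 2.
  by rewrite -(real_normK (num_real D)); nra.
rewrite ge_min; have [D2|D2] := leP (-2) D.
  have D0 : 0 <= 1 + D / 2 by lra.
  have : (1 + D / 2) ^+ 2 <= expR D.
    rewrite [D in expR D]splitr expRD -expr2 ler_pXn2r ?nnegrE ?expR_ge0//.
    exact: expR_ge1Dx.
  by move=> h; apply/orP; left; rewrite /exp_excess; nra.
by apply/orP; right; have := expR_gt0 D; rewrite /exp_excess; lra.
Qed.

End Gain.

Section Window.
Context {R : realType}.
Variable beta0 : R.
Local Notation step := (glarma_step beta0).

Definition window (y : nat -> nat) k t := [seq y i | i <- iota (t - k) k].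

Definition good k m y t :=
  [&& (k < t)%N, 0%N \in window y k t & all (fun i => i < m)%N (window y k t)].

Lemma glarma_step0 (g w : R) : step g w 0 = beta0 - g.
Proof. by rewrite /glarma_step mul0r sub0r mulrN1. Qed.

Lemma foldl_step_forget (g a b : R) s : 0%N \in s ->
  foldl (step g) a s = foldl (step g) b s.
Proof.
elim: s a b => //= y s IH a b; rewrite inE => /orP[/eqP <-|ys]; last exact: IH.
by rewrite !glarma_step0.
Qed.

Lemma foldl_window (g : R) (y : nat -> nat) (f : nat -> R) s k :
  (forall t, (1 <= t)%N -> f t.+1 = step g (f t) (y t)) -> (1 <= s)%N ->
  f (s + k)%N = foldl (step g) (f s) [seq y i | i <- iota s k].
Proof.
move=> fS; elim: k s => [|k IH] s s1; first by rewrite addn0.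
by rewrite addnS -addSn IH//= fS.
Qed.

Lemma glarma_WS (g : R) y t : (1 <= t)%N ->
  glarma_W beta0 g y t.+1 = step g (glarma_W beta0 g y t) (y t).
Proof. by rewrite /= => ->. Qed.

Lemma good_recursion (g : R) y (f : nat -> R) k m t :
  (forall t, (1 <= t)%N -> f t.+1 = step g (f t) (y t)) -> good k m y t ->
  f t = foldl (step g) 0 (window y k t).
Proof.
move=> fS /and3P[kt z _]; rewrite -[in LHS](subnK (ltnW kt)).
by rewrite (foldl_window k fS) ?subn_gt0//; exact: foldl_step_forget.
Qed.

(** Finitely many steps from a bounded start stay in a region that depends only
    on the bounds; no contraction is involved. *)
Lemma foldl_step_bounded (B A : R) (m k : nat) : exists C, forall g a s,
  `|g| <= B -> `|a| <= A -> size s = k -> all (fun i => i < m)%N s ->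
  `|foldl (step g) a s| <= C.
Proof.
elim: k A => [|k IH] A; first by exists A => g a [].
have [C HC] := IH (`|beta0| + B * (m%:R * expR A + 1)).
exists C => g a [//|y s] gB aA /= [sk] /andP[ym ms]; apply: HC => //.
rewrite /glarma_step (le_trans (ler_normD _ _))// lerD2l normrM.
apply: ler_pM => //; apply: (le_trans (ler_normB _ _)); rewrite normr1 lerD2r.
rewrite normrM ger0_norm// ger0_norm ?expR_ge0//.
apply: ler_pM; rewrite ?expR_ge0 ?ler_nat ?(ltnW ym)// ler_expR.
by move: aA; rewrite ler_norml => /andP[]; lra.
Qed.

(** The first observation is [y 1], which excludes [t = 1]. *)
Definition zero_before (y : nat -> nat) t : bool := (1 < t)%N && (y t.-1 == 0%N).

Lemma zero_before_recursion (g : R) y (f : nat -> R) t :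
  (forall t, (1 <= t)%N -> f t.+1 = step g (f t) (y t)) -> zero_before y t ->
  f t = beta0 - g.
Proof.
move=> fS /andP[t1 /eqP y0]; case: t t1 y0 => [//|[//|t]] _ /= y0.
by rewrite fS// y0 glarma_step0.
Qed.

Lemma sum_zero_before_shift y n j :
  (\sum_(1 <= t < n.+1) zero_before y (t - j) <=
   \sum_(1 <= t < n.+1) zero_before y t)%N.
Proof.
have E i : (\sum_(1 <= t < n.+1) zero_before y (t - i) =
            \sum_(0 <= t < n.+1) zero_before y (t - i))%N.
  by rewrite [RHS]big_nat_recl// big_add1.
have E0 : (\sum_(1 <= t < n.+1) zero_before y t =
           \sum_(0 <= t < n.+1) zero_before y t)%N.
  by rewrite [RHS]big_nat_recl// big_add1.
rewrite E E0; elim: j => [|j IH]; first by under eq_bigr do rewrite subn0.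
apply: leq_trans IH.
rewrite big_nat_recl//= [X in (_ <= X)%N]big_nat_recr//= /zero_before/= add0n.
by under eq_bigr do rewrite subSS; rewrite leq_addr.
Qed.

(** Each good time sees a zero among the previous [k] observations, and each
    zero is seen by at most [k] times. *)
Lemma count_good y k m n :
  (n <= \sum_(1 <= t < n.+1) ~~ good k m y t +
        k * \sum_(1 <= t < n.+1) zero_before y t)%N.
Proof.
have h : (\sum_(1 <= t < n.+1) \sum_(0 <= j < k) zero_before y (t - j) <=
          k * \sum_(1 <= t < n.+1) zero_before y t)%N.
  rewrite exchange_big /=; apply: leq_trans
    (leq_sum _ (fun j _ => sum_zero_before_shift y n j)) _.
  by rewrite sum_nat_const_nat subn0.
apply: leq_trans (leq_add (leqnn _) h); rewrite -big_split /=.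
apply: (@leq_trans (\sum_(1 <= t < n.+1) 1)).
  by rewrite sum_nat_const_nat subn1 muln1.
apply: leq_sum => t _; case: (boolP (good k m y t)) => //= /and3P[kt + _].
move=> /mapP[i]; rewrite mem_iota => /andP[ti it] y0.
have jk : (t - i.+1 < k)%N by lia.
rewrite add0n big_mkord (bigD1 (Ordinal jk))//= /zero_before.
have -> : (t - (t - i.+1))%N = i.+1 by lia.
by rewrite /= -y0 eqxx andbT; have -> : (1 < i.+1)%N by lia.
Qed.

(** Windows range over a finite type, so that the martingale part becomes a
    finite sum. *)
Definition hit k m (v : k.-tuple 'I_m) (y : nat -> nat) t : bool :=
  [&& (k < t)%N, window y k t == map val v & 0%N \in map val v].

(** A good time hits exactly one window. *)
Lemma sum_hit k m y t (F : seq nat -> R) :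
  (good k m y t)%:R * F (window y k t) =
  \sum_(v : k.-tuple 'I_m) (hit v y t)%:R * F (map val v).
Proof.
have [/and3P[kt z wm]|ngood] := boolP (good k m y t); last first.
  rewrite mul0r big1// => v _; have [/and3P[kt /eqP E z]|] := boolP (hit v y t).
    case/negP: ngood; rewrite /good kt E z /=.
    by apply/allP => _ /mapP[i _ ->]; exact: ltn_ord.
  by rewrite mul0r.
have m0 : (0 < m)%N by move/allP: wm => /(_ _ z).
case: m m0 wm => // m _ wm.
pose v := [tuple (inord (y (t - k + i)%N) : 'I_m.+1) | i < k].
have E : map val v = window y k t.
  apply: (@eq_from_nth _ 0%N); first by rewrite size_map size_tuple size_map size_iota.
  move=> i; rewrite size_map size_tuple => ik.
  rewrite (nth_map ord0) ?size_tuple// (nth_map 0%N) ?size_iota// nth_iota//.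
  rewrite -[i]/(val (Ordinal ik)) -tnth_nth tnth_mktuple /= inordK//.
  move/allP: wm; apply; apply/mapP; exists (t - k + i)%N => //.
  by rewrite mem_iota; lia.
rewrite (bigD1 v)//= E big1 ?addr0.
  by rewrite /hit kt E eqxx z.
move=> u uv; have [/and3P[_ /eqP E' _]|] := boolP (hit u y t); last by rewrite mul0r.
by case/eqP: uv; apply/val_inj/(inj_map val_inj); rewrite /= -E' E.
Qed.

End Window.

(** * The deterministic comparison on one path *)

Section Comparison.
Context {R : realType}.
Variables (beta0 gamma1 : R) (y : nat -> nat) (w : nat -> R).
Hypothesis wS : forall t, (1 <= t)%N -> w t.+1 = glarma_step beta0 gamma1 (w t) (y t).
Local Notation step := (glarma_step beta0).
Local Notation fW g t := (glarma_W beta0 g y t).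

(** Lower bound for [mu_t (exp D_t - 1 - D_t)] just after a zero, where
    [mu_t = exp (beta0 - gamma1)] and [D_t = gamma1 - g]. *)
Definition separation (e : R) : R := expR (beta0 - gamma1) * Num.min (e ^+ 2 / 4) 1.

Lemma separation_gt0 e : 0 < e -> 0 < separation e.
Proof.
move=> e0; rewrite mulr_gt0 ?expR_gt0// lt_min ltr01 andbT.
by rewrite divr_gt0// exprn_gt0.
Qed.

Definition window_gap (g : R) (s : seq nat) : R :=
  foldl (step g) 0 s - foldl (step gamma1) 0 s.

(** At a good time the filter and the truth are both functions of the window;
    if moreover the last observation is zero, they are [beta0 - g] and
    [beta0 - gamma1]. *)
Lemma gain_good (g e : R) k m t : 0 < e -> e <= `|g - gamma1| -> good k m y t ->
  gain (w t) (fW g t) (y t) <=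
  ((y t)%:R - expR (w t)) * window_gap g (window y k t)
  - separation e * (zero_before y t)%:R.
Proof.
move=> e0 eg gt; rewrite gainE /window_gap.
rewrite -(good_recursion (@glarma_WS _ beta0 g y) gt).
rewrite -(good_recursion wS gt) lerD2l lerN2.
case: (boolP (zero_before y t)) => zt; last first.
  by rewrite mulr0 mulr_ge0 ?expR_ge0 ?exp_excess_ge0.
rewrite mulr1 (zero_before_recursion wS zt).
rewrite (zero_before_recursion (@glarma_WS _ beta0 g y) zt).
rewrite /separation ler_pM2l ?expR_gt0//; apply: exp_excess_ge => //.
have -> : beta0 - g - (beta0 - gamma1) = - (g - gamma1) by ring.
by rewrite normrN.
Qed.

(** Along the process this is a martingale, and it is the same for every [g]. *)
Definition window_sum k m (v : k.-tuple 'I_m) n : R :=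
  \sum_(1 <= t < n.+1) (hit v y t)%:R * ((y t)%:R - expR (w t)).

Definition bad_cost k m (c : R) n : R :=
  \sum_(1 <= t < n.+1) (~~ good k m y t)%:R * (chi2 (w t) (y t) + c).

(** At bad times a zero has to be paid for twice: once because it does not
    reduce the gain, once because [count_good] loses the bad times; this is the
    constant [2 * separation e] in the cost of bad times. *)
Lemma sum_gain_le (g e C : R) k m n : 0 < e -> e <= `|g - gamma1| -> (0 < k)%N ->
  (forall h s, h = g \/ h = gamma1 -> size s = k -> all (fun i => i < m)%N s ->
     `|foldl (step h) 0 s| <= C) ->
  \sum_(1 <= t < n.+1) gain (w t) (fW g t) (y t) <=
  2 * C * \sum_(v : k.-tuple 'I_m) `|window_sum v n|
  + bad_cost k m (2 * separation e) n - separation e / k%:R * n%:R.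
Proof.
move=> e0 eg k0 HC; set c := separation e; have c0 : 0 < c by exact: separation_gt0.
have pointwise t : gain (w t) (fW g t) (y t) <=
   ((good k m y t)%:R * (((y t)%:R - expR (w t)) * window_gap g (window y k t))
    + (~~ good k m y t)%:R * (chi2 (w t) (y t) + c)) - c * (zero_before y t)%:R.
  case: (boolP (good k m y t)) => [gt|_] /=.
    rewrite mul1r mul0r addr0; exact: (gain_good e0 eg gt).
  rewrite mul0r add0r mul1r.
  have := gain_chi2 (w t) (fW g t) (y t); case: (zero_before y t) => /=; lra.
apply: le_trans (ler_sum _ (fun t _ => pointwise t)) _.
rewrite big_split big_split /= sumrN -mulr_sumr.
have main : \sum_(1 <= t < n.+1) (good k m y t)%:R *
      (((y t)%:R - expR (w t)) * window_gap g (window y k t)) <=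
   2 * C * \sum_(v : k.-tuple 'I_m) `|window_sum v n|.
  have -> : \sum_(1 <= t < n.+1) (good k m y t)%:R *
      (((y t)%:R - expR (w t)) * window_gap g (window y k t)) =
    \sum_(v : k.-tuple 'I_m) window_gap g (map val v) * window_sum v n.
    under [RHS]eq_bigr do rewrite mulr_sumr.
    rewrite exchange_big /=; apply: eq_bigr => t _.
    have := sum_hit k m y t (fun s => ((y t)%:R - expR (w t)) * window_gap g s).
    by move=> -> ; apply: eq_bigr => v _; ring.
  rewrite mulr_sumr; apply: ler_sum => v _; apply: le_trans (ler_norm _) _.
  rewrite normrM ler_wpM2r//.
  have sv : size (map val v) = k by rewrite size_map size_tuple.
  have av : all (fun i => i < m)%N (map val v).
    by apply/allP => _ /mapP[i _ ->]; exact: ltn_ord.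
  apply: le_trans (ler_normB _ _) _.
  have := HC g _ (or_introl erefl) sv av; have := HC gamma1 _ (or_intror erefl) sv av.
  lra.
have cost : bad_cost k m (2 * c) n =
    \sum_(1 <= t < n.+1) (~~ good k m y t)%:R * (chi2 (w t) (y t) + c)
    + c * \sum_(1 <= t < n.+1) (~~ good k m y t)%:R.
  rewrite mulr_sumr -big_split /=; apply: eq_bigr => t _; ring.
have cnt : n%:R <= \sum_(1 <= t < n.+1) (~~ good k m y t)%:R +
                   k%:R * \sum_(1 <= t < n.+1) (zero_before y t)%:R :> R.
  have := count_good y k m n; rewrite -(ler_nat R) natrD natrM !natr_sum.
  exact.
have kR : 1 <= k%:R :> R by rewrite ler1n.
rewrite cost; move: main cnt.
set B := \sum_(_ <= _ < _) (~~ _)%:R; set Z := \sum_(_ <= _ < _) (zero_before _ _)%:R.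
move=> main cnt; have B0 : 0 <= B by apply: sumr_ge0.
have : c / k%:R * n%:R <= c * B + c * Z.
  have ck : 0 < c / k%:R by rewrite divr_gt0// (lt_le_trans ltr01).
  apply: (@le_trans _ _ (c / k%:R * (B + k%:R * Z))); first by rewrite ler_pM2l.
  rewrite mulrDr mulrA divfK ?gt_eqF ?(lt_le_trans ltr01)// lerD2r ler_wpM2r//.
  by rewrite ler_pdivrMr ?(lt_le_trans ltr01)// ler_peMr// ltW.
lra.
Qed.

Definition start_error K : R :=
  \sum_(1 <= t < K.+1) `|gain (w t) (fW gamma1 t) (y t)|.

Lemma coupling s t : (1 <= s)%N -> y s = 0%N -> (s < t)%N -> fW gamma1 t = w t.
Proof.
move=> s1 ys; elim: t => // t IH; rewrite ltnS leq_eqVlt => /orP[/eqP <-|st].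
  by rewrite glarma_WS// wS// ys !glarma_step0.
have t1 := leq_trans s1 (ltnW st).
by rewrite glarma_WS// wS// IH.
Qed.

(** The terms after the first zero vanish, so that finitely many terms serve
    every [n]. *)
Lemma start_error_ge K n : (exists2 s, (1 <= s <= K)%N & y s = 0%N) ->
  - \sum_(1 <= t < n.+1) gain (w t) (fW gamma1 t) (y t) <= start_error K.
Proof.
move=> [s /andP[s1 sK] ys].
apply: le_trans (ler_norm _) _; rewrite normrN.
apply: le_trans (ler_norm_sum _ _ _) _.
apply: (@le_trans _ _ (\sum_(1 <= t < (n + K).+1)
    `|gain (w t) (fW gamma1 t) (y t)|)).
  rewrite [leRHS](big_cat_nat (n := n.+1))//=; last by rewrite ltnS leq_addr.
  by rewrite lerDl sumr_ge0.
rewrite (big_cat_nat (n := K.+1))//=; last by rewrite ltnS leq_addl.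
rewrite [X in _ + X <= _](_ : _ = 0) ?addr0//.
rewrite big_nat big1// => t /andP[Kt _].
by rewrite (coupling s1 ys) ?(leq_ltn_trans sK)// /gain subrr normr0.
Qed.

(** The criterion is maximal at [g], so the gain of [g] over the truth, minus
    that of the filter at [gamma1], is nonnegative.  The left-hand side grows
    linearly, while all the terms on the right are small compared with [n]. *)
Lemma argmax_bound (g e C : R) k m n K : 0 < e -> e <= `|g - gamma1| -> (0 < k)%N ->
  (forall h s, h = g \/ h = gamma1 -> size s = k -> all (fun i => i < m)%N s ->
     `|foldl (step h) 0 s| <= C) ->
  (exists2 s, (1 <= s <= K)%N & y s = 0%N) ->
  glarma_L beta0 gamma1 y n <= glarma_L beta0 g y n ->
  separation e / k%:R * n%:R <=
    2 * C * \sum_(v : k.-tuple 'I_m) `|window_sum v n|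
    + bad_cost k m (2 * separation e) n + start_error K.
Proof.
move=> e0 eg k0 HC ex LL.
have := sum_gain_le n e0 eg k0 HC; have := start_error_ge n ex.
have : 0 <= \sum_(1 <= t < n.+1) gain (w t) (fW g t) (y t) -
            \sum_(1 <= t < n.+1) gain (w t) (fW gamma1 t) (y t).
  rewrite -sumrB; move: LL; rewrite -subr_ge0 /glarma_L -sumrB.
  congr (0 <= _); apply: eq_bigr => t _; rewrite /gain /loglik; ring.
lra.
Qed.

End Comparison.

(** * Probabilities of windows *)

Section WindowEvents.
Context {R : realType} d (T : measurableType d) (P : probability T R).
Variables (beta0 gamma1 : R) (Y : nat -> {RV P >-> nat}) (W : nat -> {RV P >-> R}).
Hypothesis model : glarma_model P beta0 gamma1 Y W.

Local Notation history t := (glarma_history Y W t).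
Local Notation past t := (g_sigma_algebraType (glarma_history Y W t)).
Local Notation mu t x := (expR (W t x)).
Local Notation Ypath x := (fun t => Y t x).
Local Notation Wpath x := (fun t => W t x).

(** Any predicate will do because finite sequences of naturals are countably
    many. *)
Lemma history_map t (Q : seq nat -> bool) (s : seq nat) :
  all (fun i => 0 < i < t)%N s -> history t [set x | Q [seq Y i x | i <- s]].
Proof.
elim: s Q => [|i s IH] Q /=.
  move=> _; rewrite -history_measurableE; case: (Q [::]).
    by rewrite (_ : mkset _ = setT)//; apply/seteqP; split.
  by rewrite (_ : mkset _ = set0)//; apply/seteqP; split.
move=> /andP[it ts].
have -> : [set x | Q (Y i x :: [seq Y i x | i <- s])] =
    \bigcup_n (Y i @^-1` [set n] `&` [set x | Q (n :: [seq Y i x | i <- s])]).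
  apply/seteqP; split => x /=; first by exists (Y i x).
  by move=> [n _ [/= ->]].
rewrite -history_measurableE; apply: bigcupT_measurable => n.
rewrite history_measurableE; apply: history_setI; first exact: history_preimage.
exact: (IH (fun s => Q (n :: s))).
Qed.

Lemma history_window t k (Q : seq nat -> bool) : (k < t)%N ->
  history t [set x | Q (window (Ypath x) k t)].
Proof.
move=> kt; apply: history_map; apply/allP => i; rewrite mem_iota; lia.
Qed.

Definition bad_set k m t : set T := [set x | ~~ good k m (Ypath x) t].

Lemma history_bad_set k m t : history t (bad_set k m t).
Proof.
have [kt|kt] := boolP (k < t)%N.
  have := history_window (fun s => ~~ ((0%N \in s) && all (fun i => i < m)%N s)) kt.
  by rewrite /bad_set /good kt.
rewrite -history_measurableE (_ : bad_set k m t = setT)//.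
by apply/seteqP; split => // x _; rewrite /bad_set /good /= (negbTE kt).
Qed.

Lemma measurable_bad_set k m t : measurable (bad_set k m t).
Proof. have Ht := @history_bad_set k m t; exact: history_measurable Ht. Qed.

Lemma history_hit k m (v : k.-tuple 'I_m) t : history t [set x | hit v (Ypath x) t].
Proof.
have [kt|kt] := boolP (k < t)%N.
  have := history_window (fun s => (s == map val v) && (0%N \in map val v)) kt.
  by rewrite /hit kt.
rewrite -history_measurableE (_ : mkset _ = set0)//.
by apply/seteqP; split => // x; rewrite /hit /= (negbTE kt).
Qed.

Local Open Scope ereal_scope.

(** The condition on [t] keeps the window away from [Y_1], whose tail is not
    controlled by [tail_Y]. *)
Lemma bad_set_le j m t (e : R) : (0 <= e)%R -> (j.*2.+1 < t)%N ->
  (forall s, (2 <= s)%N -> P [set x | (m <= Y s x)%N] <= e%:E) ->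
  P (bad_set j.*2 m t) <= ((1 - zero_rate beta0 gamma1) ^+ j + j.*2%:R * e)%:E.
Proof.
move=> e0 kt mP; set k := j.*2 in kt *.
pose B i : set T := [set x | (m <= Y (t - k + i) x)%N].
have mB i : measurable (B i).
  have -> : B i = Y (t - k + i)%N @^-1` [set n | (m <= n)%N] by [].
  by rewrite -[X in measurable X]setTI; exact: measurable_funP.
have s1 : (1 <= t - k)%N by lia.
have mN := @measurable_nozero _ _ _ P Y W (t - k) k s1.
have mU : measurable (\big[setU/set0]_(i < k) B i) by exact: bigsetU_measurable.
apply: (@le_trans _ _ (P (nozero Y (t - k) k `|` \big[setU/set0]_(i < k) B i))).
  apply: le_measure; rewrite ?inE; [exact: measurable_bad_set|exact: measurableU|].
  move=> x; rewrite /bad_set /good /= (ltnW kt) /= negb_and => /orP[z|/allPn[n]].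
    left=> i /andP[ti it]; apply: contra z => /eqP <-.
    by apply/mapP; exists i => //; rewrite mem_iota ti.
  move=> /mapP[i]; rewrite mem_iota => /andP[ti it] -> ; rewrite -leqNgt => mY.
  right; rewrite -bigcup_mkord; exists (i - (t - k))%N => /=; first lia.
  by rewrite /B /= subnKC.
apply: le_trans (measureU2 _ mN mU) _.
rewrite EFinD; apply: leeD; first exact: (nozero_le model).
apply: le_trans (Boole_inequality P _) _ => //.
apply: (@le_trans _ _ (\sum_(i < k) e%:E)).
  by apply: lee_sum => i _; apply: mP; lia.
by rewrite sumEFin sumr_const card_ord mulr_natl.
Qed.

Lemma measurable_chi2 t : measurable_fun setT (fun x => chi2 (W t x) (Y t x)).
Proof.
have mw : measurable_fun setT (fun x => mu t x) by exact: measurableT_comp.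
apply: measurable_funM.
  apply: measurable_funX; apply: measurable_funB => //.
  exact: (measurable_of_nat (fun n => n%:R : R)).
under eq_fun do rewrite -expRN.
by apply: measurableT_comp => //; exact: measurableT_comp.
Qed.

Lemma bad_indicE k m t x : (~~ good k m (Ypath x) t)%:R = \1_(bad_set k m t) x :> R.
Proof. by rewrite indic_pred. Qed.

Lemma measurable_bad_cost k m (c : R) n :
  measurable_fun setT (fun x => bad_cost (Ypath x) (Wpath x) k m c n).
Proof.
apply: measurable_sum => t; under eq_fun do rewrite bad_indicE.
apply: measurable_funM.
  by apply: measurable_indic; exact: measurable_bad_set.
by apply: measurable_funD => //; exact: measurable_chi2.
Qed.

(** Whether [t] is bad is known from the past, and the chi-square term has
    conditional mean one.  Nothing better than probability one is known for the
    first [k + 1] times. *)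
Lemma integral_bad_cost k m (c h : R) n : (0 <= c)%R -> (0 <= h)%R ->
  (forall t, (k.+1 < t)%N -> P (bad_set k m t) <= h%:E) ->
  \int[P]_x (bad_cost (Ypath x) (Wpath x) k m c n)%:E <=
  ((1 + c) * (k.+1%:R + n%:R * h))%:E.
Proof.
move=> c0 h0 Ph.
pose f t x := (\1_(bad_set k m t) x * (chi2 (W t x) (Y t x) + c))%R.
have f0 t x : (0 <= f t x)%R by rewrite mulr_ge0// addr_ge0// chi2_ge0.
have mI t : measurable_fun setT (\1_(bad_set k m t) : T -> R).
  by apply: measurable_indic; exact: measurable_bad_set.
have mf t : measurable_fun setT (f t).
  by apply: measurable_funM => //; apply: measurable_funD => //; exact: measurable_chi2.
have -> : \int[P]_x (bad_cost (Ypath x) (Wpath x) k m c n)%:E =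
    \sum_(1 <= t < n.+1) \int[P]_x (f t x)%:E.
  rewrite -ge0_integral_sum//.
  - apply: eq_integral => x _; rewrite sumEFin; congr EFin.
    by apply: eq_bigr => t _; rewrite bad_indicE.
  - by move=> t; exact/measurable_EFinP.
  - by move=> t x _; rewrite lee_fin.
have Ef t : (1 <= t)%N -> \int[P]_x (f t x)%:E = (1 + c)%:E * P (bad_set k m t).
  move=> t1; rewrite /f; under eq_integral do
    rewrite mulrDr EFinD [(_ * c)%R]mulrC [(c * _)%:E]EFinM.
  rewrite ge0_integralD//.
  - have -> := integral_chi2 model t1 (@history_bad_set k m t).
    rewrite ge0_integralZl//.
    + rewrite integral_indic ?setIT//; last exact: measurable_bad_set.
      by rewrite EFinD ge0_muleDl ?mul1e// lee_fin.
    + exact/measurable_EFinP.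
  - by move=> x _; rewrite lee_fin mulr_ge0// chi2_ge0.
  - by apply/measurable_EFinP; apply: measurable_funM => //; exact: measurable_chi2.
  - by move=> x _; rewrite mule_ge0// lee_fin.
  - by apply: measurable_funeM; exact/measurable_EFinP.
apply: (@le_trans _ _
  (\sum_(1 <= t < n.+1) ((1 + c) * ((t <= k.+1)%N%:R + h))%:E)).
  rewrite big_nat [leRHS]big_nat; apply: lee_sum => t /andP[t1 _].
  rewrite Ef// EFinM; apply: lee_wpmul2l; first by rewrite lee_fin addr_ge0.
  case: leqP => kt; last by rewrite add0r; exact: Ph.
  apply: (@le_trans _ _ 1%:E).
    by apply: probability_le1; exact: measurable_bad_set.
  by rewrite lee_fin lerDl.
rewrite sumEFin lee_fin -mulr_sumr ler_wpM2l ?addr_ge0// big_split /= lerD//.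
  rewrite -natr_sum ler_nat.
  suff : (\sum_(1 <= t < n.+1) (t <= k.+1) <= minn n k.+1)%N.
    by move=> /leq_trans; apply; exact: geq_minr.
  elim: n => [|n IH]; first by rewrite big_geq.
  rewrite big_nat_recr//=; apply: leq_trans (leq_add IH (leqnn _)) _.
  by case: leqP; lia.
by rewrite sumr_const_nat subn1 mulr_natl.
Qed.

(** When a window with a zero is hit, [W_t] is a function of this window, hence
    bounded. *)
Lemma window_sum_second_moment k m (v : k.-tuple 'I_m) (C : R) n :
  (`|foldl (glarma_step beta0 gamma1) 0 (map val v)| <= C)%R ->
  \int[P]_x (window_sum (Ypath x) (Wpath x) v n ^+ 2)%:E <= (n%:R * expR C)%:E.
Proof.
move=> vC.
apply: (martingale_transform_second_moment model
  (c := fun t x => (hit v (Ypath x) t)%:R)).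
- exact: expR_ge0.
- move=> t t1.
  have -> : (fun x => (hit v (Ypath x) t)%:R) =
      \1_[set x | hit v (Ypath x) t] :> (T -> R).
    by apply/funext => x; rewrite indic_pred.
  exact: (measurable_indic_past (@history_hit k m v t)).
- move=> t x t1; have [vt|] := boolP (hit v (Ypath x) t); last first.
    by rewrite expr0n mul0r expR_ge0.
  rewrite expr1n mul1r ler_expR; move: (vt) => /and3P[kt /eqP E z].
  have gt : good k m (Ypath x) t.
    by rewrite /good kt E z; apply/allP => _ /mapP[i _ ->]; exact: ltn_ord.
  have wS s : (1 <= s)%N -> W s.+1 x = glarma_step beta0 gamma1 (W s x) (Y s x).
    by move=> s1; rewrite (W_step model).
  rewrite (good_recursion (f := fun t => W t x) wS gt) E.
  by apply: le_trans vC; exact: ler_norm.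
Qed.

Lemma measurable_window_sum k m (v : k.-tuple 'I_m) n :
  measurable_fun setT (fun x => window_sum (Ypath x) (Wpath x) v n).
Proof.
apply: measurable_sum => t.
have -> : (fun x => (hit v (Ypath x) t)%:R * ((Y t x)%:R - mu t x))%R =
  (fun x => \1_[set x | hit v (Ypath x) t] x * ((Y t x)%:R - mu t x))%R.
  by apply/funext => x; rewrite indic_pred.
apply: measurable_funM.
  have Ht := @history_hit k m v t.
  by apply: measurable_indic; exact: history_measurable Ht.
apply: measurable_funB; first exact: (measurable_of_nat (fun n => n%:R : R)).
exact: measurableT_comp.
Qed.

Lemma measurable_glarma_W g t :
  measurable_fun setT (fun x => glarma_W beta0 g (Ypath x) t).
Proof.
have mc := @measurable_cst _ _ T _ setT (beta0 + g * 0)%R.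
elim: t => [|[|t] IH]; [exact: mc|exact: mc|].
have -> : (fun x => glarma_W beta0 g (Ypath x) t.+2) =
  (fun x => glarma_step beta0 g (glarma_W beta0 g (Ypath x) t.+1) (Y t.+1 x)) by [].
exact: measurable_glarma_step.
Qed.

Lemma measurable_start_error K :
  measurable_fun setT (fun x => start_error beta0 gamma1 (Ypath x) (Wpath x) K).
Proof.
have mY t : measurable_fun setT (fun x => (Y t x)%:R : R).
  exact: (measurable_of_nat (fun n => n%:R : R)).
have ml t (f : T -> R) : measurable_fun setT f ->
    measurable_fun setT (fun x => loglik (f x) (Y t x)).
  move=> mf; apply: measurable_funB; first exact: measurable_funM.
  exact: measurableT_comp.
apply: measurable_sum => t; apply: measurableT_comp => //.
by apply: measurable_funB; apply: ml => //; exact: measurable_glarma_W.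
Qed.

Lemma cvg_tail0 (D : T -> R) (a : R) : (0 < a)%R -> measurable_fun setT D ->
  P [set x | a * n%:R <= D x]%R @[n --> \oo] --> 0.
Proof.
move=> a0 mD; pose F n := [set x | a * n%:R <= D x]%R.
have mF n : measurable (F n).
  by rewrite -[F n]setTI; exact: measurable_fun_le.
have F0 : \bigcap_n F n = set0.
  apply/seteqP; split => // x /(_ (Num.truncn (D x / a)).+1 I); rewrite /F /=.
  by rewrite mulrC -ler_pdivlMr// leNgt truncnS_gt.
have := @nonincreasing_cvg_mu _ _ _ P F; rewrite F0 measure0; apply => //.
- by apply: le_lt_trans (probability_le1 _ (mF 0%N)) _; rewrite ltry.
- move=> p q pq; apply/subsetPset => x; rewrite /F /=; apply: le_trans.
  by rewrite ler_wpM2l ?(ltW a0)// ler_nat.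
Qed.

End WindowEvents.

(** * Consistency *)

Section Consistency.
Context {R : realType} d (T : measurableType d) (P : probability T R).
Variables (beta0 gamma1 : R) (Y : nat -> {RV P >-> nat}) (W : nat -> {RV P >-> R}).
Hypothesis model : glarma_model P beta0 gamma1 Y W.
Local Notation Ypath x := (fun t => Y t x).
Local Notation Wpath x := (fun t => W t x).
Local Open Scope ereal_scope.

(** The part of the bound of [argmax_bound] that has a controlled expectation,
    once the absolute values of the window sums have been traded for squares at
    the cost of [q]. *)
Definition fluctuation k m (C c q : R) n x : R :=
  (#|{: k.-tuple 'I_m}|%:R / (4 * q) *
     (\sum_(v : k.-tuple 'I_m) (2 * C * window_sum (Ypath x) (Wpath x) v n) ^+ 2)
  + bad_cost (Ypath x) (Wpath x) k m c n)%R.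

Lemma measurable_fluctuation k m (C c q : R) n :
  measurable_fun setT (fluctuation k m C c q n).
Proof.
apply: measurable_funD; last exact: measurable_bad_cost.
apply: measurable_funM => //; apply: measurable_sum => v.
by apply: measurable_funX; apply: measurable_funM => //; exact: measurable_window_sum.
Qed.

Lemma bad_cost_ge0 k m (c : R) n x : (0 <= c)%R ->
  (0 <= bad_cost (Ypath x) (Wpath x) k m c n)%R.
Proof.
by move=> c0; apply: sumr_ge0 => t _; rewrite mulr_ge0// addr_ge0// chi2_ge0.
Qed.

Lemma fluctuation_ge0 k m (C c q : R) n x : (0 <= c)%R -> (0 < q)%R ->
  (0 <= fluctuation k m C c q n x)%R.
Proof.
move=> c0 q0; rewrite addr_ge0 ?bad_cost_ge0//.
rewrite mulr_ge0 ?divr_ge0 ?mulr_ge0 ?(ltW q0)// sumr_ge0// => v _.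
exact: sqr_ge0.
Qed.

Lemma integral_fluctuation k m (C c q h : R) n :
  (0 <= c)%R -> (0 < q)%R -> (0 <= h)%R ->
  (forall s, size s = k -> all (fun i => i < m)%N s ->
     `|foldl (glarma_step beta0 gamma1) 0 s| <= C)%R ->
  (forall t, (k.+1 < t)%N -> P (bad_set Y k m t) <= h%:E) ->
  \int[P]_x (fluctuation k m C c q n x)%:E <=
  (#|{: k.-tuple 'I_m}|%:R / (4 * q) *
     (#|{: k.-tuple 'I_m}|%:R * ((2 * C) ^+ 2 * (n%:R * expR C)))
   + (1 + c) * (k.+1%:R + n%:R * h))%:E.
Proof.
move=> c0 q0 h0 HC Ph; set N : R := #|_|%:R.
have Nq0 : (0 <= N / (4 * q))%R by rewrite divr_ge0// mulr_ge0// ltW.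
have ms (v : k.-tuple 'I_m) : measurable_fun setT
    (fun x => window_sum (Ypath x) (Wpath x) v n ^+ 2)%R.
  by apply: measurable_funX; exact: measurable_window_sum.
have S0 x : (0 <= \sum_(v : k.-tuple 'I_m)
    (2 * C * window_sum (Ypath x) (Wpath x) v n) ^+ 2)%R.
  by apply: sumr_ge0 => v _; exact: sqr_ge0.
have mS : measurable_fun setT (fun x => \sum_(v : k.-tuple 'I_m)
    (2 * C * window_sum (Ypath x) (Wpath x) v n) ^+ 2)%R.
  apply: measurable_sum => v; under eq_fun do rewrite exprMn.
  exact: measurable_funM.
under eq_integral do rewrite EFinD EFinM.
rewrite ge0_integralD//; last 4 first.
- by move=> x _; rewrite -EFinM lee_fin mulr_ge0.
- by apply: measurable_funeM; exact/measurable_EFinP.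
- by move=> x _; rewrite lee_fin bad_cost_ge0.
- by apply/measurable_EFinP; exact: measurable_bad_cost.
rewrite [leRHS]EFinD; apply: leeD; last exact: (integral_bad_cost model).
rewrite ge0_integralZl//; last 2 first.
- exact/measurable_EFinP.
- by move=> x _; rewrite lee_fin.
rewrite [leRHS]EFinM; apply: lee_wpmul2l; first by rewrite lee_fin.
under eq_integral do rewrite -sumEFin.
rewrite ge0_integral_sum//; last 2 first.
- move=> v; apply/measurable_EFinP; under eq_fun do rewrite exprMn.
  exact: measurable_funM.
- by move=> v x _; rewrite lee_fin sqr_ge0.
apply: (@le_trans _ _ (\sum_(v : k.-tuple 'I_m) ((2 * C) ^+ 2 * (n%:R * expR C))%:E)).
  apply: lee_sum => v _; under eq_integral do rewrite exprMn EFinM.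
  rewrite ge0_integralZl//.
  - rewrite [leRHS]EFinM; apply: lee_wpmul2l; first by rewrite lee_fin sqr_ge0.
    apply: (window_sum_second_moment model); apply: HC.
      by rewrite size_map size_tuple.
    by apply/allP => _ /mapP[i _ ->]; exact: ltn_ord.
  - exact/measurable_EFinP.
  - by move=> x _; rewrite lee_fin sqr_ge0.
  - by rewrite lee_fin sqr_ge0.
by rewrite sumEFin sumr_const /N [(#|_|%:R * _)%R]mulr_natl.
Qed.

(** In [argmax_bound] the left-hand side is [4 a n]; the trade for squares and
    the starting error take at most [a n] each. *)
Lemma fluctuation_large (e C g : R) k m K n x :
  let a := (separation beta0 gamma1 e / (4 * k%:R))%R in
  (0 <= C)%R -> (0 < e)%R -> (0 < k)%N -> (0 < n)%N -> (e <= `|g - gamma1|)%R ->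
  (forall h s, h = g \/ h = gamma1 -> size s = k -> all (fun i => i < m)%N s ->
     `|foldl (glarma_step beta0 h) 0 s| <= C)%R ->
  (glarma_L beta0 gamma1 (Ypath x) n <= glarma_L beta0 g (Ypath x) n)%R ->
  ~ nozero Y 1 K x ->
  (start_error beta0 gamma1 (Ypath x) (Wpath x) K < a * n%:R)%R ->
  (2 * a * n%:R <= fluctuation k m C (2 * separation beta0 gamma1 e) (a * n%:R) n x)%R.
Proof.
move=> a C0 e0 k0 n0 eg HC LL nz D.
have s0 := separation_gt0 beta0 gamma1 e0.
have kR : (0 < k%:R :> R)%R by rewrite ltr0n.
have a0 : (0 < a)%R by rewrite divr_gt0// mulr_gt0.
have wS t : (1 <= t)%N -> W t.+1 x = glarma_step beta0 gamma1 (W t x) (Y t x).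
  by move=> t1; rewrite (W_step model).
have ex : exists2 s, (1 <= s <= K)%N & Y s x = 0%N.
  apply: contrapT => nex; apply: nz => i; rewrite add1n ltnS => iK.
  by apply/eqP => Yi; apply: nex; exists i.
have := argmax_bound (w := Wpath x) wS e0 eg k0 HC ex LL.
have an0 : (0 < a * n%:R)%R by rewrite mulr_gt0// ltr0n.
have := sum_abs_le_sqr (fun v : k.-tuple 'I_m =>
  2 * C * window_sum (Ypath x) (Wpath x) v n)%R an0.
have -> : (\sum_(v : k.-tuple 'I_m) `|2 * C * window_sum (Ypath x) (Wpath x) v n| =
  2 * C * \sum_(v : k.-tuple 'I_m) `|window_sum (Ypath x) (Wpath x) v n|)%R.
  rewrite mulr_sumr; apply: eq_bigr => v _.
  by rewrite normrM [in LHS]ger0_norm// mulr_ge0.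
have -> : (separation beta0 gamma1 e / k%:R * n%:R = 4 * (a * n%:R))%R.
  by rewrite /a; field; rewrite gt_eqF.
rewrite /fluctuation -mulrA => am det; lra.
Qed.

End Consistency.

Theorem theorem1 (R : realType) (d : measure_display) (T : measurableType d)
    (P : probability T R) (beta0 gamma1 : R) (Gamma : set R)
    (Y : nat -> {RV P >-> nat}) (W : nat -> {RV P >-> R})
    (ghat : nat -> {RV P >-> R})
    (Gamma_compact : compact Gamma)
    (Gamma_not0 : ~ Gamma 0)
    (Gamma_gamma1 : Gamma gamma1)
    (model : glarma_model P beta0 gamma1 Y W)
    (stationary : invariant_distribution (glarma_kernel beta0 gamma1)
                    (distribution P (W 1%N)))
    (ghat_argmax : forall n, (1 <= n)%N -> forall w : T,
       is_argmax Gamma (fun g => glarma_L beta0 g (fun t => Y t w) n)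
         (ghat n w)) :
  cvg_in_probability P ghat (cst gamma1).
Proof.
move=> eps eps0; apply: cvge0_eventually_le => // delta delta0.
have [B GB] : exists B, forall g, Gamma g -> `|g| <= B.
  have [M [_ MG]] := compact_bounded Gamma_compact.
  by exists (M + 1) => g Gg; apply: (MG (M + 1)) => //; rewrite ltrDl.
set sep := separation beta0 gamma1 eps.
have sep0 : 0 < sep by exact: separation_gt0.
have rate := zero_rate_itv beta0 gamma1.
set r := zero_rate beta0 gamma1 in rate *.
(* [th] bounds [k] times the proportion of bad times, so that their cost stays
   below half of what Markov's inequality allows. *)
pose th := delta * sep / (8 * (1 + 2 * sep)).
have th0 : 0 < th by apply: divr_gt0; apply: mulr_gt0 => //; lra.
have th4 : 0 < th / 4 by rewrite divr_gt0.
have [j j0 jth] := exists_geometric_le rate th4.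
have d4 : 0 < delta / 4 by rewrite divr_gt0.
(* The window [1, 2 i] contains a zero up to probability [delta / 4]. *)
have [i i0 ith] := exists_geometric_le rate d4.
pose k := j.*2; have k0 : (0 < k)%N by rewrite double_gt0.
have kR : 0 < k%:R :> R by rewrite ltr0n.
(* [k] observations have to be below [m], hence one more factor [k]. *)
pose tl := th / (2 * k%:R ^+ 2).
have tl0 : 0 < tl by rewrite divr_gt0// mulr_gt0// exprn_gt0.
have [m m0 mP] := tail_Y model tl0.
pose h := (1 - r) ^+ j + k%:R * tl.
have q0 : 0 <= 1 - r by move: rate; lra.
have h0 : 0 <= h by rewrite addr_ge0 ?exprn_ge0// mulr_ge0// ltW.
have badP t : (k.+1 < t)%N -> (P (bad_set Y k m t) <= h%:E)%E.
  by move=> kt; apply: (bad_set_le model) => //; exact: ltW.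
have kh : k%:R * h <= th.
  have -> : k%:R * h = 2 * (j%:R * (1 - r) ^+ j) + th / 2.
    rewrite /h /tl mulrDr /k -muln2 natrM; congr (_ + _); first by ring.
    by field; rewrite pnatr_eq0 -lt0n.
  move: jth; lra.
have [C HC] := foldl_step_bounded beta0 B 0 m k.
have C0 : 0 <= C.
  pose s0 := nseq k 0%N; have : `|foldl (glarma_step beta0 gamma1) 0 s0| <= C.
    apply: HC; [exact: GB|by rewrite normr0|by rewrite size_nseq|].
    by rewrite all_nseq m0 orbT.
  exact: le_trans.
pose a := sep / (4 * k%:R).
have a0 : 0 < a by rewrite divr_gt0// mulr_gt0.
pose K := i.*2.
pose N : R := #|{: k.-tuple 'I_m}|%:R.
pose c1 := N ^+ 2 * C ^+ 2 * expR C / a + (1 + 2 * sep) * k.+1%:R.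
have PK : (P (nozero Y 1 K) <= (delta / 4)%:E)%E.
  apply: le_trans (nozero_le model _ _) _ => //; rewrite lee_fin.
  apply: le_trans ith; rewrite ler_peMl ?exprn_ge0// ler1n//.
have mD := @measurable_start_error _ _ _ P beta0 gamma1 Y W K.
have PD := cvg_tail0 P a0 mD.
have da0 : 0 < delta * a / 2 by rewrite divr_gt0// mulr_gt0.
near=> n.
have n0 : (0 < n)%N by near: n; exists 1%N.
have nR : 0 < n%:R :> R by rewrite ltr0n.
have nc1 : c1 <= n%:R * (delta * a / 2).
  rewrite -ler_pdivrMr//.
  by near: n; exact: nbhs_infty_ger.
have PDn : (P [set x | a * n%:R <=
    start_error beta0 gamma1 (fun t => Y t x) (fun t => W t x) K]%R
    <= (delta / 4)%:E)%E.
  by near: n; exact: (fine_near_le PD d4).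
have an0 : 0 < a * n%:R by rewrite mulr_gt0.
have sep2 : 0 <= 2 * sep by rewrite mulr_ge0// ltW.
pose X := fluctuation Y W k m C (2 * sep) (a * n%:R) n.
have mX : measurable_fun setT X by exact: measurable_fluctuation.
have EX : (\int[P]_x (X x)%:E <= (2 * a * n%:R * (delta / 2))%:E)%E.
  apply: le_trans (integral_fluctuation model n sep2 an0 h0 _ badP) _.
    by move=> s ss sm; apply: (HC gamma1 0 s) => //; [exact: GB|rewrite normr0].
  rewrite lee_fin -/N.
  have -> : N / (4 * (a * n%:R)) * (N * ((2 * C) ^+ 2 * (n%:R * expR C))) =
     N ^+ 2 * C ^+ 2 * expR C / a by field; rewrite !gt_eqF.
  have : (1 + 2 * sep) * h <= delta * a / 2.
    have -> : delta * a / 2 = (1 + 2 * sep) * (th / k%:R).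
      by rewrite /th /a; field; rewrite !gt_eqF//; lra.
    by rewrite ler_wpM2l ?addr_ge0// ler_pdivlMr// mulrC.
  move: nc1; rewrite /c1; nra.
have PX : (P [set x | 2 * a * n%:R <= X x]%R <= (delta / 2)%:E)%E.
  have an2 : 0 < 2 * a * n%:R by rewrite -mulrA mulr_gt0.
  have mA : measurable [set x | 2 * a * n%:R <= X x].
    by rewrite -[X in measurable X]setTI; exact: measurable_fun_le.
  have X0 x : 0 <= X x by exact: fluctuation_ge0.
  have := le_trans (markov_ge0 P an2 X0 mX) EX.
  rewrite -(fineK (fin_num_measure P _ mA)) -EFinM !lee_fin.
  by rewrite ler_pM2l.
(* Off these three events, [ghat n] is within [eps] of [gamma1]. *)
set A1 := nozero Y 1 K in PK; set A2 := [set x | _] in PDn; set A3 := [set x | _] in PX.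
have mA1 : measurable A1 by exact: measurable_nozero.
have mA2 : measurable A2 by rewrite -[A2]setTI; exact: measurable_fun_le.
have mA3 : measurable A3 by rewrite -[A3]setTI; exact: measurable_fun_le.
apply: (@le_trans _ _ (P (A1 `|` A2 `|` A3))).
  apply: le_measure; rewrite ?inE.
  - have mE : measurable [set x | `|ghat n x - gamma1| <= eps].
      rewrite -[X in measurable X]setTI; apply: measurable_fun_le => //.
      by apply: measurableT_comp => //; exact: measurable_funB.
    rewrite (_ : mkset _ = ~` [set x | `|ghat n x - gamma1| <= eps]).
      exact: measurableC.
    by apply/seteqP; split => x /=; rewrite ltNge => /negP.
  - by apply: measurableU => //; exact: measurableU.
  move=> x /= xe.
  have [|nz] := pselect (A1 x); first by left; left.
  have [|nD] := pselect (A2 x); first by left; right.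
  right; have [gG gmax] := ghat_argmax n n0 x.
  apply: (fluctuation_large model (e := eps) (g := ghat n x) (K := K)) => //.
  - exact: ltW.
  - move=> g s [] -> ss sm; apply: HC => //; rewrite ?normr0//; exact: GB.
  - exact: gmax.
  - by rewrite ltNge; apply/negP.
apply: le_trans (measureU2 _ _ _) _ => //; first exact: measurableU.
have -> : delta = delta / 4 + delta / 4 + delta / 2 by field.
rewrite !EFinD; apply: leeD => //; apply: le_trans (measureU2 _ mA1 mA2) _.
exact: leeD.
Unshelve. all: by end_near. Qed.
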